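(* Let $k$ be an algebraically closed field of characteristic $p>3$ and let $\alpha\in k$. If $p\equiv1\pmod3$ and $\alpha\notin\mathbf{F}_p$, the $p$-divisor of the foliation $\mathcal{F}^4_\alpha$ on $\mathbf{P}^2_k$ is $$\Delta_{\mathcal{F}^4_\alpha}=\frac{p+2}{3}\,\mathcal{H},$$ where $\mathcal{H}\subset\mathbf{P}^2_k$ is the (reduced) union of the nine lines $(x^3-y^3)(y^3-z^3)(z^3-x^3)=0$. In particular, the only irreducible invariant curves of $\mathcal{F}^4_\alpha$ are the components of $\mathcal{H}$.
   Context: For $\alpha\in k$, $\mathcal{F}^4_\alpha$ is the foliation on $\mathbf{P}^2_k$ given by the kernel of $(y^3-z^3)(yz-\alpha x^2)\,dx+(z^3-x^3)(xz-\alpha y^2)\,dy+(x^3-y^3)(xy-\alpha z^2)\,dz$. $p$-divisor: let $X$ be a smooth algebraic surface over $k$ and $\mathcal{F}$ a foliation by curves on $X$, given on an open cover $\{U_i\}$ by local generators $v_i$ of the tangent sheaf $T_{\mathcal{F}}$ and $\omega_i$ of the conormal sheaf $N^*_{\mathcal{F}}$. For a derivation $v$, its $p$-fold composition $v^{[p]}$ is again a derivation. $\mathcal{F}$ is $p$-closed if $v_i\wedge v_i^{[p]}=0$ for all $i$. The functions $\omega_i(v_i^{[p]})$ glue to a global section $s_{\mathcal{F}}\in H^0(X,K_{\mathcal{F}}^{\otimes p}\otimes N_{\mathcal{F}})$ (where $K_{\mathcal{F}}=T_{\mathcal{F}}^*$), which vanishes identically if and only if $\mathcal{F}$ is $p$-closed.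 If $\mathcal{F}$ is not $p$-closed, its $p$-divisor $\Delta_{\mathcal{F}}$ is the zero divisor of $s_{\mathcal{F}}$. *)

(* Defs.v *)
From HB Require Import structures.
From mathcomp Require Import all_boot all_order all_algebra.
From mathcomp Require Import boolp.
From mathcomp Require Import mpoly.
From mathcomp Require Import ring.

Set Implicit Arguments.
Unset Strict Implicit.
Unset Printing Implicit Defensive.

Import GRing.Theory.
Local Open Scope ring_scope.

Definition mdivides n (R : idomainType) (f g : {mpoly R[n]}) : Prop :=
  exists h, g = h * f.

Definition mirreducible n (R : idomainType) (f : {mpoly R[n]}) : Prop :=
  f \isn't a GRing.unit /\
  forall g h, f = g * h -> g \is a GRing.unit \/ h \is a GRing.unit.

(* The order of vanishing of g along f = 0 is m; in particular g != 0. *)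
Definition vanishing_order n (R : idomainType) (f g : {mpoly R[n]}) (m : nat)
    : Prop :=
  mdivides (f ^+ m) g /\ ~ mdivides (f ^+ m.+1) g.

(* Irreducible curves of P^2.  The leading coefficient is normalized so that
   each curve has exactly one equation. *)
Record curve (k : closedFieldType) := Curve {
  equation :> {mpoly k[3]};
  curve_irreducible : mirreducible equation;
  curve_homog : exists d, equation \is d.-homog;
  curve_monic : mleadc equation = 1 }.

(* Effective divisors of P^2, given by the multiplicity of each irreducible
   curve.  Finiteness of the support is not recorded: it is automatic for zero
   divisors of sections and for reduced divisors of nonzero forms. *)
Definition effective_divisor (k : closedFieldType) := curve k -> nat.

Definition component (k : closedFieldType) (C : curve k) (G : {mpoly k[3]}) :=
  mdivides (C : {mpoly k[3]}) G.

Definition reduced_divisor (k : closedFieldType) (G : {mpoly k[3]})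
    : effective_divisor k :=
  fun C => nat_of_bool `[< component C G >].

(* Restriction to the chart U_i = {X_i <> 0} = A^2: set X_i = 1 and use the
   other two variables, in increasing order, as affine coordinates. *)
Definition dehom (k : closedFieldType) (i : 'I_3) (f : {mpoly k[3]})
    : {mpoly k[2]} :=
  f \mPo [tuple if unlift i j is Some m then 'X_m else 1 | j < 3].

Definition derivation (k : closedFieldType)
    (D : {mpoly k[2]} -> {mpoly k[2]}) : Prop :=
  linear D /\ forall f g, D (f * g) = D f * g + f * D g.

(* The pairing of the 1-form \sum_j eta_j dX_j with a derivation. *)
Definition contract (k : closedFieldType) (eta : 'rV[{mpoly k[2]}]_2)
    (D : {mpoly k[2]} -> {mpoly k[2]}) : {mpoly k[2]} :=
  \sum_(j < 2) eta 0 j * D 'X_j.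

(* A nonzero twisted 1-form \sum_j F_j dX_j, in H^0(P^2, Omega^1(d + 2)).
   The foliation it defines is its kernel in the tangent sheaf. *)
Record foliation (k : closedFieldType) (d : nat) := Foliation {
  form :> 'rV[{mpoly k[3]}]_3;
  form_neq0 : form != 0;
  form_homog : forall j, form 0 j \is d.+1.-homog;
  form_euler : \sum_(j < 3) form 0 j * 'X_j = 0 }.

Section PDivisor.

Variables (k : closedFieldType) (d : nat) (F : foliation k d).

Definition chart_form (i : 'I_3) : 'rV[{mpoly k[2]}]_2 :=
  \row_j dehom i (form F 0 (lift i j)).

(* Sections over U_i of the tangent sheaf T_F ... *)
Definition tangent (i : 'I_3) (D : {mpoly k[2]} -> {mpoly k[2]}) : Prop :=
  derivation D /\ contract (chart_form i) D = 0.

(* ... and of the conormal sheaf N^*_F, the annihilator of T_F in Omega^1. *)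
Definition conormal (i : 'I_3) (eta : 'rV[{mpoly k[2]}]_2) : Prop :=
  forall D, tangent i D -> contract eta D = 0.

Definition tangent_generator (i : 'I_3) (v : {mpoly k[2]} -> {mpoly k[2]}) :=
  tangent i v /\
  forall D, tangent i D -> exists g, forall f, D f = g * v f.

Definition conormal_generator (i : 'I_3) (eta : 'rV[{mpoly k[2]}]_2) :=
  conormal i eta /\ forall theta, conormal i theta -> exists g, theta = g *: eta.

Definition wedge (v w : {mpoly k[2]} -> {mpoly k[2]}) : {mpoly k[2]} :=
  v 'X_0 * w 'X_1 - v 'X_1 * w 'X_0.

Definition p_closed (p : nat) : Prop :=
  forall i v, tangent_generator i v -> wedge v (iter p v) = 0.

(* D is the zero divisor of the section s_F that is omega_i(v_i^[p]) on U_i.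
   The curve C meets U_i exactly when dehom i C is not a unit. *)
Definition is_p_divisor (p : nat) (D : effective_divisor k) : Prop :=
  ~ p_closed p /\
  exists (v : 'I_3 -> {mpoly k[2]} -> {mpoly k[2]})
         (omega : 'I_3 -> 'rV[{mpoly k[2]}]_2),
    (forall i, tangent_generator i (v i) /\ conormal_generator i (omega i)) /\
    forall i (C : curve k), dehom i C \isn't a GRing.unit ->
      vanishing_order (dehom i C) (contract (omega i) (iter p (v i))) (D C).

Definition invariant_curve (C : curve k) : Prop :=
  forall i D, tangent i D -> mdivides (dehom i C) (D (dehom i C)).

End PDivisor.

Section F4.

Variables (k : closedFieldType) (alpha : k).

Local Notation x := ('X_0 : {mpoly k[3]}).
Local Notation y := ('X_1 : {mpoly k[3]}).
Local Notation z := ('X_2 : {mpoly k[3]}).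

Definition F4_form : 'rV[{mpoly k[3]}]_3 :=
  \row_j [tuple (y ^+ 3 - z ^+ 3) * (y * z - alpha *: x ^+ 2);
                (z ^+ 3 - x ^+ 3) * (x * z - alpha *: y ^+ 2);
                (x ^+ 3 - y ^+ 3) * (x * y - alpha *: z ^+ 2)]`_j.

Fact F4_neq0 : F4_form != 0.
Proof.
have ev (v : 'I_3 -> k) i : meval v ('X_i : {mpoly k[3]}) = v i.
  exact: mevalXU.
apply/eqP => /rowP /(_ 0); rewrite !mxE /= => /eqP; rewrite mulf_eq0.
case/orP => /eqP E.
- have := congr1 (meval (fun i : 'I_3 => (i == 1)%:R)) E.
  rewrite !(mevalB, rmorphXn, meval0) /= !ev /=.
  by rewrite expr1n expr0n subr0 => /eqP; rewrite oner_eq0.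
- have := congr1 (meval (fun i : 'I_3 => (i != 0)%:R)) E.
  rewrite !(mevalB, mevalZ, mevalM, rmorphXn, meval0) /= !ev /=.
  by rewrite !mulr0 subr0 mulr1 => /eqP; rewrite oner_eq0.
Qed.

Fact F4_homog j : F4_form 0 j \is 5.-homog.
Proof.
have HX1 (i : 'I_3) : ('X_i : {mpoly k[3]}) \is 1.-homog.
  by rewrite dhomogX; apply/eqP; apply: mdeg1.
have HX (i : 'I_3) n : ('X_i : {mpoly k[3]}) ^+ n \is n.-homog.
  by rewrite -[n in n.-homog]mul1n; apply: dhomogMn.
have Hm (a b c d e : 'I_3) :
  (('X_a : {mpoly k[3]}) ^+ 3 - 'X_b ^+ 3) * ('X_c * 'X_d - alpha *: 'X_e ^+ 2)
    \is 5.-homog.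
  apply: (dhomogM (d := 3) (e := 2)); first by apply: rpredB.
  by apply: rpredB; [apply: (dhomogM (d := 1) (e := 1)) | apply: rpredZ].
by rewrite mxE; case: j => [[|[|[|//]]] /= _]; apply: Hm.
Qed.

Fact F4_euler : \sum_(j < 3) F4_form 0 j * 'X_j = 0.
Proof.
rewrite !big_ord_recl big_ord0 !mxE /= -!mul_mpolyC.
rewrite (_ : lift ord0 ord0 = 1); last exact/val_inj.
rewrite (_ : lift ord0 (lift ord0 ord0) = 2); last exact/val_inj.
rewrite (_ : ord0 = 0); last exact/val_inj.
ring.
Qed.

Definition F4 : foliation k 4 := Foliation F4_neq0 F4_homog F4_euler.

Definition nine_lines : effective_divisor k :=
  reduced_divisor ((x ^+ 3 - y ^+ 3) * (y ^+ 3 - z ^+ 3) * (z ^+ 3 - x ^+ 3)).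

End F4.

(* Main.v *)
Require Import Defs.
From HB Require Import structures.
From mathcomp Require Import all_boot all_order all_algebra.
From mathcomp Require Import fraction generic_quotient boolp mpoly ring zify.

Set Implicit Arguments.
Unset Strict Implicit.
Unset Printing Implicit Defensive.

Import GRing.Theory.
Local Open Scope ring_scope.

(** In each chart the foliation is generated by the same vector field
    v = (x^3 - 1) (x - alpha y^2) d_x + (y^3 - 1) (y - alpha x^2) d_y, and the
    nine lines are P = (x^3 - 1) (y^3 - 1) (x^3 - y^3) = 0.  Write p = 3n + 1.
    Since n = - 1/3 in k, w = P^n v plays the role of a linear vector field on
    the cover E x E of the plane, E being the elliptic curve with j = 0.  With
    the functions h = (x^3 - 1) / (y^3 - 1) and
    h0 = (x^3 - 1) y^3 / (x^3 (y^3 - 1)), which are first integrals at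
    alpha = oo and alpha = 0, both w(h) and w(h0) / alpha have the form
    3 c^p (T (T - 1))^(n+1) at T = h, resp. T = h0.  So w^p(h) and w^p(h0) are
    governed by the p-th power of one vector field on the line, which is A times
    a p-th power times this field for a nonzero constant A (the Hasse invariant
    of E).  Comparing the two and returning to v by Hochschild's formula gives
    omega(v^p) = +-(alpha - alpha^p) A P^(n+1).  The equation f of an invariant
    curve divides omega(v^p) f_x and omega(v^p) f_y by Cramer's rule, so either
    it divides P, or f_x = f_y = 0, which irreducibility excludes. *)

Local Notation "x %:F" := (@FracField.tofrac _ x).

(** * Derivations in characteristic p *)

Definition is_der (R : pzRingType) (D : R -> R) : Prop :=
  (forall a b, D (a + b) = D a + D b) /\
  (forall a b, D (a * b) = D a * b + a * D b).

Section Derivations.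

Variables (R : comNzRingType) (D : R -> R).
Hypothesis derD : is_der D.

Lemma derA a b : D (a + b) = D a + D b. Proof. exact: derD.1. Qed.

Lemma derM a b : D (a * b) = D a * b + a * D b. Proof. exact: derD.2. Qed.

Lemma der0 : D 0 = 0.
Proof. by apply: (addrI (D 0)); rewrite -derA !addr0. Qed.

Lemma derN a : D (- a) = - D a.
Proof. by apply: (addrI (D a)); rewrite -derA !subrr der0. Qed.

Lemma derB a b : D (a - b) = D a - D b.
Proof. by rewrite derA derN. Qed.

Lemma derMn a n : D (a *+ n) = D a *+ n.
Proof. by elim: n => [|n IH]; rewrite ?mulr0n ?der0 // !mulrS derA IH. Qed.

Lemma der_sum (I : Type) (r : seq I) (P : pred I) (F : I -> R) :
  D (\sum_(i <- r | P i) F i) = \sum_(i <- r | P i) D (F i).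
Proof. by elim/big_rec2: _ => [|i x y _ <-]; rewrite ?der0 ?derA. Qed.

Lemma der1 : D 1 = 0.
Proof.
by apply: (addrI (D 1)); rewrite addr0 -{3}[1]mulr1 derM mulr1 mul1r.
Qed.

Lemma derX a n : D (a ^+ n) = a ^+ n.-1 * D a *+ n.
Proof.
elim: n => [|n IH]; first by rewrite expr0 der1.
rewrite exprS derM IH; case: n {IH} => [|n] /=.
  by rewrite expr0 mulr1 mul1r mulr0 addr0.
by rewrite mulrnAr mulrA -exprS [D a * _]mulrC -mulrS.
Qed.

Lemma der_iterD n a b : iter n D (a + b) = iter n D a + iter n D b.
Proof. by elim: n => //= n ->; rewrite derA. Qed.

Lemma der_iterM n a b :
  iter n D (a * b) = \sum_(i < n.+1) iter (n - i) D a * iter i D b *+ 'C(n, i).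
Proof.
elim: n => [|n IH]; first by rewrite big_ord1 /= bin0.
rewrite iterS IH der_sum.
have E (i : 'I_n.+1) : D (iter (n - i) D a * iter i D b *+ 'C(n, i)) =
  iter (n.+1 - i) D a * iter i D b *+ 'C(n, i) +
  iter (n - i) D a * iter i.+1 D b *+ 'C(n, i).
  by rewrite derMn derM mulrnDl subSn ?iterS // -ltnS.
rewrite (eq_bigr _ (fun i _ => E i)) big_split /=.
rewrite [in RHS]big_ord_recl /= bin0.
under [in RHS]eq_bigr => i _ do rewrite /= binS mulrnDr.
rewrite big_split /= addrA; congr (_ + _).
rewrite [X in _ = _ + X]big_ord_recr /= bin_small // mulr0n addr0.
by rewrite big_ord_recl bin0.
Qed.

Section Char.

Variable p : nat.
Hypothesis charp : p \in [pchar R].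

Lemma mulrn_pchar_dvd (a : R) n : (p %| n)%N -> a *+ n = 0.
Proof.
move=> pn; rewrite -mulr_natr (eqP (_ : n%:R == 0)) ?mulr0 //.
by rewrite -(dvdn_pcharf charp).
Qed.

(** In Leibniz's formula for the p-th iterate, all binomial coefficients except the two extreme ones
    are divisible by p. *)
Lemma der_iterp : is_der (iter p D).
Proof.
have p_pr := pcharf_prime charp.
split=> [a b|a b]; first exact: der_iterD.
rewrite der_iterM; have := prime_gt0 p_pr.
case E : p => [//|q] _; rewrite big_ord_recl big_ord_recr /= bin0 ?subn0.
rewrite big1 => [|i _]; last first.
  apply: mulrn_pchar_dvd; rewrite -E prime_dvd_bin // E /bump /= add1n ltnS.
  by rewrite ltn_ord.
by rewrite add0r /bump /= add1n binn subnn.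
Qed.

Lemma der_expp a : D (a ^+ p) = 0.
Proof. by rewrite derX mulrn_pchar_dvd. Qed.

End Char.

End Derivations.

Lemma der_scale (R : comNzRingType) (D : R -> R) f :
  is_der D -> is_der (fun a => f * D a).
Proof.
move=> derD; split=> a b; first by rewrite /= (derA derD) mulrDr.
by rewrite /= (derM derD) mulrDr mulrA [f * (a * _)]mulrCA.
Qed.

Lemma der_sub (R : comNzRingType) (D E : R -> R) :
  is_der D -> is_der E -> is_der (fun a => D a - E a).
Proof.
move=> derD derE; split=> a b.
  by rewrite (derA derD) (derA derE) opprD addrACA.
by rewrite (derM derD) (derM derE) mulrBl mulrBr opprD addrACA.
Qed.

(* Hochschild's formula.  Write (f D)^p = \sum_j c_j D^j with c_p = f^p.  After
   adjoining a variable t with D t = 1, the derivation (f D)^p - f^p D^p takes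
   the value j! c_j at t^j modulo t, which must be 0 for 2 <= j < p. *)
Section Hochschild.

Variables (R : comNzRingType) (D : R -> R) (f : R).
Hypothesis derD : is_der D.

Definition der_ext (q : {poly R}) : {poly R} := map_poly D q + q^`().

Lemma coef_der_ext q i : (der_ext q)`_i = D q`_i + q`_i.+1 *+ i.+1.
Proof. by rewrite coefD coef_map_id0 ?coef_deriv // (der0 derD). Qed.

Lemma der_extP : is_der der_ext.
Proof.
have mapA : forall a b, map_poly D (a + b) = map_poly D a + map_poly D b.
  move=> a b; apply/polyP => i.
  by rewrite !(coefD, coef_map_id0) ?(der0 derD) ?(derA derD).
split=> a b; first by rewrite /der_ext mapA derivD addrACA.
rewrite /der_ext derivM mulrDl mulrDr addrACA; congr (_ + _).
apply/polyP => i; rewrite coefD coef_map_id0 ?(der0 derD) // !coefM der_sum //.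
rewrite -big_split /=; apply: eq_bigr => j _.
by rewrite (derM derD) !coef_map_id0 ?(der0 derD) //.
Qed.

Lemma der_extC c : der_ext c%:P = (D c)%:P.
Proof.
apply/polyP => i; rewrite coef_der_ext !coefC mul0rn addr0.
by case: i => //=; rewrite (der0 derD).
Qed.

Lemma iter_der_extC n c : iter n der_ext c%:P = (iter n D c)%:P.
Proof. by elim: n => //= n ->; rewrite der_extC. Qed.

(** The coefficient of D^j in (f D)^n; the recursion is f D (c D^j) = f (D c) D^j + f c D^(j+1). *)
Fixpoint scaled_coef (n j : nat) : R :=
  if n is n'.+1 then
    f * (D (scaled_coef n' j) + (if j is j'.+1 then scaled_coef n' j' else 0))
  else (j == 0%N)%:R.

Lemma scaled_coef_gt n j : (n < j)%N -> scaled_coef n j = 0.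
Proof.
elim: n j => [|n IH] [|j] //= nj.
by rewrite (IH j) // (IH j.+1) ?(ltnW nj) // (der0 derD) addr0 mulr0.
Qed.

Lemma scaled_coef_diag n : scaled_coef n n = f ^+ n.
Proof.
elim: n => //= n IH.
by rewrite scaled_coef_gt // (der0 derD) add0r IH exprS.
Qed.

Lemma scaled_coef0 n : (0 < n)%N -> scaled_coef n 0 = 0.
Proof.
case: n => // n _; elim: n => [|n IH] /=; first by rewrite (der1 derD) addr0 mulr0.
by rewrite /= in IH; rewrite IH (der0 derD) addr0 mulr0.
Qed.

Lemma iter_scaled n q :
  iter n (fun r => f%:P * der_ext r) q =
  \sum_(j < n.+1) (scaled_coef n j)%:P * iter j der_ext q.
Proof.
have derE := der_extP.
elim: n => [|n IH]; first by rewrite big_ord1 mul1r.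
rewrite iterS IH (der_sum derE).
have E (i : 'I_n.+1) : der_ext ((scaled_coef n i)%:P * iter i der_ext q) =
  (D (scaled_coef n i))%:P * iter i der_ext q +
  (scaled_coef n i)%:P * iter i.+1 der_ext q.
  by rewrite (derM derE) der_extC iterS.
rewrite (eq_bigr _ (fun i _ => E i)) big_split /= mulrDr.
rewrite [in RHS]big_ord_recl /=.
under [in RHS]eq_bigr => i _ do
  rewrite /= /bump /= add1n polyCM polyCD -mulrA mulrDl mulrDr.
rewrite big_split /= addrA !mulr_sumr; congr (_ + _).
rewrite [X in _ = _ + X]big_ord_recr /= (scaled_coef_gt (ltnSn n)) (der0 derD).
rewrite polyC0 mul0r mulr0 addr0 [in LHS]big_ord_recl /=.
by rewrite addr0 polyCM mulrA.
Qed.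

(** [D] kills the integer coefficients of the derivatives of t^j, so on these [der_ext] acts as
    d/dt. *)
Lemma coef0_iter_derX i j : (iter i der_ext 'X^j)`_0 = (i`!)%:R *+ (i == j).
Proof.
have -> : iter i der_ext 'X^j = ('X^j)^`(i).
  elim: i => //= i ->; rewrite /der_ext -[RHS]add0r derivnXn; congr (_ + _).
  apply/polyP => l; rewrite coef_map_id0 ?(der0 derD) // coefMn coefXn coef0.
  by rewrite (derMn derD) (derMn derD) (der1 derD) !mul0rn.
rewrite coef_derivn coefXn addn0 ffactnn eq_sym.
by case: (j == i); rewrite /= ?mul0rn ?mulr1n ?mulr0n.
Qed.

Variable p : nat.
Hypothesis charp : p \in [pchar R].

Lemma scaled_coef_mid j : (1 < j < p)%N -> (j`!)%:R * scaled_coef p j = 0.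
Proof.
move=> /andP[j1 jp]; have p_gt0 := prime_gt0 (pcharf_prime charp).
have charP : p \in [pchar {poly R}] by rewrite pchar_poly.
pose E q := iter p (fun r => f%:P * der_ext r) q - (f ^+ p)%:P * iter p der_ext q.
have derE : is_der E.
  apply: der_sub; last apply: der_scale.
    by apply: der_iterp => //; apply: der_scale; apply: der_extP.
  by apply: der_iterp => //; apply: der_extP.
(* The Leibniz rule gives E(t^j) = j t^(j-1) E(t), divisible by t because j >= 2. *)
have : (E 'X^j)`_0 = 0.
  rewrite (derX derE); case: j j1 {jp} => [|[|j]] //= _.
  by rewrite exprS -mulrA coefMn coefXM mul0rn.
rewrite /E iter_scaled big_ord_recr /= scaled_coef_diag addrK coef_sum.
rewrite (bigD1 (Ordinal jp)) //= coefCM coef0_iter_derX eqxx mulr1n mulrC.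
rewrite big1 ?addr0 // => i ij.
rewrite coefCM coef0_iter_derX (_ : (i == j :> nat) = false) ?mulr0 //.
exact/negbTE.
Qed.

End Hochschild.

Lemma prime_ndvd_fact p j : prime p -> (j < p)%N -> ~~ (p %| j`!)%N.
Proof.
move=> p_pr; elim: j => [|j IH] jp; first by rewrite dvdn1 neq_ltn prime_gt1 ?orbT.
rewrite factS Euclid_dvdM // negb_or IH ?andbT ?(ltnW jp) //.
by rewrite gtnNdvd.
Qed.

(** Of the terms c_j D^j only j = 1 and j = p survive: c_0 = 0, and j! is invertible for 1 < j < p.
    The witness [g] is c_1. *)
Lemma iter_scaled_der (F : fieldType) (D : F -> F) (f : F) p :
  p \in [pchar F] -> is_der D ->
  exists g, forall a, iter p (fun b => f * D b) a = f ^+ p * iter p D a + g * D a.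
Proof.
move=> charp derD; exists (scaled_coef D f p 1) => a.
have p_gt1 := prime_gt1 (pcharf_prime charp).
apply: polyC_inj; rewrite polyCD !polyCM -(iter_der_extC derD) -(der_extC derD).
have iterC n : (iter n (fun b => f * D b) a)%:P =
               iter n (fun r => f%:P * der_ext D r) a%:P.
  by elim: n => //= n <-; rewrite (der_extC derD) polyCM.
rewrite iterC.
rewrite iter_scaled // big_ord_recr /= scaled_coef_diag // addrC; congr (_ + _).
rewrite (bigD1 (Ordinal p_gt1)) //= big1 ?addr0 // => -[j jp] /= j1.
rewrite (_ : scaled_coef D f p j = 0) ?mul0r //.
have [->|j0] := posnP j; first by rewrite scaled_coef0 // ltnW.
have j2 : (1 < j < p)%N by rewrite jp andbT ltn_neqAle eq_sym j1.
have /eqP := scaled_coef_mid f derD charp j2.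
rewrite mulf_eq0 => /orP[|/eqP //].
by rewrite -(dvdn_pcharf charp) (negbTE (prime_ndvd_fact (pcharf_prime charp) jp)).
Qed.

(** * Extension of a derivation to the fraction field *)

Section QuotientRule.

Variables (F : fieldType) (n d m e n' d' m' e' : F).
Hypotheses (d_neq0 : d != 0) (e_neq0 : e != 0).

(** Independence of the quotient rule from the representative of a fraction; the second hypothesis
    is the first one differentiated. *)
Lemma quotient_rule_wd : n * e = m * d -> n' * e + n * e' = m' * d + m * d' ->
  (m' * e - m * e') / e ^+ 2 = (n' * d - n * d') / d ^+ 2.
Proof.
move=> E E'; have En : n = m * d / e by rewrite -E mulfK.
have En' : n' = (m' * d + m * d' - n * e') / e by rewrite -E' addrK mulfK.
by rewrite En' En; field; rewrite d_neq0 e_neq0.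
Qed.

Lemma quotient_rule_add :
  ((n' * e + n * e' + (m' * d + m * d')) * (d * e) -
   (n * e + m * d) * (d' * e + d * e')) / (d * e) ^+ 2 =
  (n' * d - n * d') / d ^+ 2 + (m' * e - m * e') / e ^+ 2.
Proof. by field; rewrite d_neq0 e_neq0. Qed.

Lemma quotient_rule_mul :
  ((n' * m + n * m') * (d * e) - n * m * (d' * e + d * e')) / (d * e) ^+ 2 =
  (n' * d - n * d') / d ^+ 2 * (m / e) + n / d * ((m' * e - m * e') / e ^+ 2).
Proof. by field; rewrite d_neq0 e_neq0. Qed.

End QuotientRule.

Section FractionDerivation.

Variables (R : idomainType) (D : R -> R).
Hypothesis derD : is_der D.

Lemma fracE (x : {fraction R}) : x = (\n_(repr x))%:F / (\d_(repr x))%:F.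
Proof.
have dF : (\d_(repr x))%:F != 0 by rewrite tofrac_eq0 denom_ratioP.
apply: (mulIf dF); rewrite divfK // -[x in LHS]reprK; unlock FracField.tofrac.
rewrite -[LHS]FracField.pi_mul; apply/eqmodP.
rewrite /= FracField.equivfE /FracField.mulf.
rewrite !numden_Ratio ?(oner_neq0, mulf_neq0, denom_ratioP) //.
by rewrite reprK !mulr1 mulrC.
Qed.

Definition der_frac (x : {fraction R}) : {fraction R} :=
  let n := \n_(repr x) in let d := \d_(repr x) in
  ((D n)%:F * d%:F - n%:F * (D d)%:F) / d%:F ^+ 2.

Lemma der_fracE n d : d != 0 ->
  der_frac (n%:F / d%:F) = ((D n)%:F * d%:F - n%:F * (D d)%:F) / d%:F ^+ 2.
Proof.
move=> d_neq0; rewrite /der_frac; set x := n%:F / d%:F.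
have := fracE x; have := denom_ratioP (repr x).
move: (\n_(repr x)) (\d_(repr x)) => n' d' d'_neq0 E.
have dF : d%:F != 0 by rewrite tofrac_eq0.
have d'F : d'%:F != 0 by rewrite tofrac_eq0.
have E1 : n * d' = n' * d.
  apply/eqP; rewrite -tofrac_eq !tofracM; apply/eqP.
  by rewrite -[n%:F](divfK dF) -/x E mulrAC divfK.
have E2 : (D n)%:F * d'%:F + n%:F * (D d')%:F =
          (D n')%:F * d%:F + n'%:F * (D d)%:F.
  by rewrite -!tofracM -!tofracD -!(derM derD) E1.
apply: (quotient_rule_wd _ _ _ E2) => //.
by rewrite -!tofracM E1.
Qed.

Lemma der_fracF a : der_frac a%:F = (D a)%:F.
Proof.
rewrite -[a%:F]divr1 -tofrac1 der_fracE ?oner_neq0 //.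
by rewrite (der1 derD) tofrac0 mulr0 subr0 tofrac1 expr1n !divr1 mulr1.
Qed.

Lemma der_fracP : is_der der_frac.
Proof.
have H (x : {fraction R}) : exists n d, d != 0 /\ x = n%:F / d%:F.
  by exists (\n_(repr x)), (\d_(repr x)); split; [exact: denom_ratioP|exact: fracE].
split=> x y; have [n [d [d0 ->]]] := H x; have [m [e [e0 ->]]] := H y.
- rewrite addf_div ?tofrac_eq0 // -!tofracM -tofracD.
  rewrite !der_fracE ?mulf_neq0 // (derA derD) !(derM derD) !(tofracD, tofracM).
  by apply: quotient_rule_add; rewrite tofrac_eq0.
- rewrite mulf_div -!tofracM !der_fracE ?mulf_neq0 //.
  rewrite !(derM derD) !(tofracD, tofracM).
  by apply: quotient_rule_mul; rewrite tofrac_eq0.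
Qed.

Lemma iter_der_frac n a : iter n der_frac a%:F = (iter n D a)%:F.
Proof. by elim: n => //= n ->; rewrite der_fracF. Qed.

End FractionDerivation.

(** * The one-variable vector field 3 (T (T - 1))^(n+1) d/dT *)

Lemma closed_root (k : closedFieldType) (n : nat) (a : k) :
  (0 < n)%N -> exists b, b ^+ n = a.
Proof.
move=> n0; have [|b] := closed_rootP ('X^n - a%:P) _.
  by rewrite size_XnsubC // eqSS -lt0n.
by rewrite rootE !hornerE subr_eq0 => /eqP; exists b.
Qed.

Section OneVariable.

Variables (k : closedFieldType) (p n : nat).
Hypotheses (charp : p \in [pchar k]) (pE : p = (3 * n).+1).

Let p_pr : prime p := pcharf_prime charp.

Let charP : p \in [pchar {poly k}].
Proof. by rewrite pchar_poly. Qed.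

Lemma deriv_eq0_coef (f : {poly k}) i : f^`() = 0 -> ~~ (p %| i)%N -> f`_i = 0.
Proof.
move=> f0; case: i => [|i]; first by rewrite dvdn0.
rewrite (dvdn_pcharf charp) => i0.
have /eqP : f^`()`_i = 0 by rewrite f0 coef0.
by rewrite coef_deriv -mulr_natr mulf_eq0 (negbTE i0) orbF => /eqP.
Qed.

(** Only exponents divisible by p occur in [f], and [k] contains p-th roots of its coefficients;
    additivity of Frobenius assembles the root. *)
Lemma deriv_eq0_exp (f : {poly k}) : f^`() = 0 -> exists g, f = g ^+ p.
Proof.
move=> f0; have p_gt0 := prime_gt0 p_pr.
pose r i := sval (cid (closed_root (f`_(i * p)) p_gt0)).
have rE i : r i ^+ p = f`_(i * p) by rewrite /r; case: cid.
exists (\poly_(i < size f) r i).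
rewrite poly_def -(pFrobenius_autE charP) rmorph_sum /=.
under eq_bigr => i _ do
  rewrite pFrobenius_autE -mul_polyC exprMn -polyC_exp rE -exprM mul_polyC.
apply/polyP => j; rewrite coef_sum.
under eq_bigr => i _ do rewrite coefZ coefXn.
have [pj|pj] := boolP (p %| j)%N; last first.
  rewrite deriv_eq0_coef // big1 // => i _.
  by case: eqP => [E|]; rewrite ?mulr0 //; rewrite E dvdn_mull in pj.
have jE := divnK pj.
have [jf|jf] := ltnP (j %/ p) (size f).
  rewrite (bigD1 (Ordinal jf)) //= jE eqxx mulr1 big1 ?addr0 // => i ij.
  case: eqP => [E|]; rewrite ?mulr0 //; case/eqP: ij; apply/val_inj => /=.
  by rewrite E mulnK.
rewrite nth_default; last by rewrite (leq_trans jf) ?leq_div.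
rewrite big1 // => i _; case: eqP => [E|]; rewrite ?mulr0 //.
by move: jf; rewrite E mulnK // leqNgt ltn_ord.
Qed.

Local Notation q := ('X * ('X - 1) : {poly k}).
Local Notation phi := (3%:R * q ^+ n.+1 : {poly k}).

(* As 3 (n + 1) = p + 2, this is u^p times the invariant vector field 3 u^2 d/dT
   of the elliptic curve u^3 = T (T - 1). *)
Definition hasse_der (f : {poly k}) : {poly k} := phi * f^`().

Lemma hasse_derP : is_der hasse_der.
Proof.
by apply: der_scale; split=> a b; rewrite ?derivD ?derivM.
Qed.

Let n_gt0 : (0 < n)%N.
Proof. by case: n pE p_pr => // ->. Qed.

Let q_neq0 : q != 0.
Proof. by rewrite mulf_neq0 ?polyX_eq0 // -[1]/(1%:P) polyXsubC_eq0. Qed.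

Let size_q : size q = 3.
Proof.
have X1 : 'X - 1 != 0 :> {poly k} by rewrite -[1]/(1%:P) polyXsubC_eq0.
by rewrite mulrC size_mulX // -[1]/(1%:P) size_XsubC.
Qed.

Let size_qX m : size (q ^+ m) = (2 * m).+1.
Proof.
have := size_exp q m; rewrite size_q /= => <-.
by rewrite prednK // size_poly_gt0 expf_neq0.
Qed.

Let three_neq0 : 3%:R != 0 :> {poly k}.
Proof.
rewrite -(dvdn_pcharf charP); apply/negP => /dvdn_leq.
by move=> /(_ isT); move: n_gt0; rewrite pE; lia.
Qed.

Let phi_neq0 : phi != 0.
Proof. by rewrite mulf_neq0 // expf_neq0. Qed.

Lemma size_hasse_der f : (size (hasse_der f) <= size f + (2 * n).+1)%N.
Proof.
have [->|f0] := eqVneq f 0; first by rewrite /hasse_der deriv0 mulr0 size_poly0.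
have := lt_size_deriv f0; rewrite /hasse_der -mulrA => lt.
rewrite -polyC_natr mul_polyC (leq_trans (size_scale_leq _ _)) //.
by rewrite (leq_trans (size_polyMleq _ _)) // size_qX; lia.
Qed.

(** Differentiation lowers the power of [q] by at most one, and [phi] contributes n + 1. *)
Lemma hasse_der_dvd m f : exists g, hasse_der (q ^+ m * f) = q ^+ (m + n) * g.
Proof.
exists (3%:R * (f * q^`() *+ m + q * f^`())).
rewrite /hasse_der derivM deriv_exp exprD.
case: m => [|m] /=; first by rewrite !mulr0n mul0r !add0r !mul1r exprSr -!mulrA mulrCA.
rewrite -[_ *+ m.+1]mulr_natr -[f * _ *+ _]mulr_natr !exprS.
have E (R : comNzRingType) (c Q Q' u w a b M : R) :
  c * (Q * w) * (Q' * u * M * a + Q * u * b) = Q * u * w * (c * (a * Q' * M + Q * b)).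
  by ring.
exact: E.
Qed.

Lemma dvdp_q_exp r : (exists g, r ^+ p = q * g) -> exists g, r = q * g.
Proof.
case=> g E; have p_gt0 := prime_gt0 p_pr.
have : root r 0.
  have : r.[0] ^+ p == 0 by rewrite -horner_exp E !hornerE ?mul0r.
  by rewrite expf_eq0 p_gt0 rootE.
case/factor_theorem => r1; rewrite subr0 => r1E.
have : root r1 1.
  have : r.[1] ^+ p == 0 by rewrite -horner_exp E !hornerE ?subrr ?mulr0 ?mul0r.
  by rewrite expf_eq0 p_gt0 r1E !hornerE rootE.
case/factor_theorem => r2 r2E; exists r2.
by rewrite r1E r2E polyC1 mulrC [r2 * _]mulrC mulrA.
Qed.

(** The orders of [r ^+ p] at 0 and 1 are multiples of p, so pm + 1 is rounded up to p(m + 1). *)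
Lemma dvdp_qn_exp m r : (exists g, r ^+ p = q ^+ (p * m).+1 * g) ->
  exists g, r = q ^+ m.+1 * g.
Proof.
elim: m r => [|m IH] r [g E].
  by rewrite expr1; apply: dvdp_q_exp; exists g; rewrite E muln0 expr1.
have [r1 r1E] : exists g, r = q * g.
  by apply: dvdp_q_exp; exists (q ^+ (p * m.+1) * g); rewrite E exprS mulrA.
have [|r2 r2E] := IH r1.
  exists g; apply: (mulfI (expf_neq0 p q_neq0)).
  by rewrite -exprMn -r1E E mulrA -exprD mulnS addnS.
by exists r2; rewrite r1E r2E (exprS _ m.+1) mulrA.
Qed.

Lemma hasse_der_iterp_const : exists a,
  iter p hasse_der 'X = a *: q ^+ (p * n + n.+1).
Proof.
have derD := hasse_derP; have p_gt0 := prime_gt0 p_pr.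
set g := iter p hasse_der 'X.
(* The p-th iterate is a derivation killing constants, so its value at X determines it. *)
have Dp f : iter p hasse_der f = f^`() * g.
  have derDp := der_iterp derD charP.
  elim/poly_ind: f => [|f c IH].
    by rewrite (der0 derDp) deriv0 mul0r.
  rewrite (derA derDp) (derM derDp) IH derivD derivM derivX derivC addr0 mulr1.
  have -> : iter p hasse_der c%:P = 0.
    case: p p_gt0 => // m _; rewrite iterSr /hasse_der derivC mulr0.
    by elim: m => //= m ->; rewrite deriv0 mulr0.
  by rewrite addr0 mulrDl mulrAC.
(* D commutes with D^p, so g = D^p X and phi = D X have the same logarithmic
   derivative; hence q^(2n) g, like q^(2n) phi = 3 q^p, is a p-th power. *)
have eqg : phi * g^`() = phi^`() * g.
  by rewrite -Dp -[LHS]/(iter p.+1 hasse_der 'X) iterSr {2}/hasse_der derivX mulr1.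
have E0 : (q ^+ (2 * n) * g)^`() = 0.
  apply: (mulfI phi_neq0); rewrite mulr0 derivM mulrDr [phi * (_ * g^`())]mulrCA eqg.
  rewrite [phi * _]mulrA [_ * (_ * g)]mulrA -mulrDl.
  have -> : phi * (q ^+ (2 * n))^`() + q ^+ (2 * n) * phi^`() =
            (3%:R * q ^+ p)^`().
    have -> : 3%:R * q ^+ p = q ^+ (2 * n) * phi.
      by rewrite mulrCA -exprD; congr (_ * _ ^+ _); lia.
    by rewrite [in RHS]derivM [phi * _]mulrC.
  rewrite derivM deriv_exp (mulrn_pchar_dvd charP _ (dvdnn p)) mulr0 addr0.
  by rewrite -polyC_natr derivC !mul0r.
have [r rE] := deriv_eq0_exp E0.
(* The first application gives 3 q^(n+1), and each of the other p - 1 raises the exponent by n. *)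
have [u uE] : exists u, g = q ^+ (p * n).+1 * u.
  rewrite /g; case: {rE eqg E0 Dp g}p p_gt0 => // m _; elim: m => [|m [u IH]].
    rewrite mul1n /= /hasse_der derivX mulr1.
    by exists 3%:R; rewrite mulrC.
  rewrite iterS IH; have [v ->] := hasse_der_dvd (m.+1 * n).+1 u.
  by exists v; rewrite mulSn addSn addnC.
have [|s sE] := @dvdp_qn_exp n r.
  by exists (q ^+ (2 * n) * u); rewrite -rE uE mulrCA.
have sg m : (size (iter m hasse_der 'X) <= 2 + m * (2 * n).+1)%N.
  elim: m => [|m IH]; first by rewrite size_polyX.
  by rewrite iterS (leq_trans (size_hasse_der _)) // mulSn; lia.
(* The exponents agree because p(n + 1) = 2n + (pn + n + 1). *)
have gE : q ^+ (2 * n) * g = q ^+ (2 * n) * (q ^+ (p * n + n.+1) * s ^+ p).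
  rewrite rE sE exprMn mulrA -exprD -exprM; congr (_ ^+ _ * _); nia.
have {}gE := mulfI (expf_neq0 _ q_neq0) gE.
have [s0|s0] := eqVneq s 0.
  by exists 0; rewrite gE s0 expr0n eqn0Ngt p_gt0 mulr0 scale0r.
(* The degree of [g] is at most 1 + p(2n + 1), and that of [q ^+ (p * n + n.+1)] is 2pn + 2n + 2.
   The difference is n < p, leaving no room for a nonconstant [s ^+ p]. *)
have : (size s <= 1)%N.
  have := sg p; rewrite -/g gE size_mul ?expf_neq0 // size_qX.
  have := size_exp s p; have := size_poly_gt0 s; rewrite s0.
  have := size_poly_gt0 (s ^+ p); rewrite expf_neq0 //.
  move: (size _) (size _) => a b; rewrite pE; nia.
move=> /size1_polyC sC; exists (s`_0 ^+ p).
by rewrite gE {1}sC -polyC_exp mulrC mul_polyC.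
Qed.

(** Up to sign this is the binomial coefficient C(2n, n), which divides (2n)! with 2n < p. It is
    also the coefficient of T^(p-1) in (T (T - 1))^(2n), that is, the Hasse invariant of u^3 = T (T
    - 1). *)
Lemma central_coef_neq0 : (('X - 1 : {poly k}) ^+ (2 * n))`_n != 0.
Proof.
have N1 : - 1 = (- 1)%:P :> {poly k} by rewrite polyCN.
have n2 : (n < (2 * n).+1)%N by lia.
rewrite exprDn coef_sum (bigD1 (Ordinal n2)) //= big1 ?addr0 => [|i ni].
  rewrite mul2n -addnn addnK N1 -polyC_exp coefMn coefMC coefXn eqxx mul1r.
  rewrite -mulr_natr mulf_eq0 expf_eq0 oppr_eq0 oner_eq0 andbF /=.
  rewrite -(dvdn_pcharf charp).
  have : ~~ (p %| (n + n)`!)%N by apply: prime_ndvd_fact => //; rewrite pE; lia.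
  by apply: contra => pC; rewrite -(bin_fact (leq_addr n n)) dvdn_mulr.
rewrite N1 -polyC_exp coefMn coefMC coefXn [_ == _](_ : _ = false) ?mul0r ?mul0rn //.
apply: contraNF ni => /eqP ni; apply/eqP/val_inj => /=.
by have := ltn_ord i; lia.
Qed.

Lemma hasse_der_iterp_neq0 : iter p hasse_der 'X != 0.
Proof.
have derD := hasse_derP; have p_gt0 := prime_gt0 p_pr.
(* Otherwise some c = D^m X is a nonzero constant of D, and then q^(2n) c is the
   derivative of 3 q^p D^(m-1) X; but its coefficient of degree deg c + 3n is
   nonzero, while deg c + 3n + 1 is divisible by p. *)
apply/eqP => gp0.
pose P m := iter m hasse_der 'X == 0.
have exP : exists m, P m by exists p; apply/eqP.
case: (ex_minnP exP) => m /eqP m0 minm.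
have [m1 mE] : exists m1, m = m1.+2.
  case: m m0 minm => [|[|m]] m0 minm; last by exists m.
    by move/eqP: m0; rewrite /= polyX_eq0.
  by move/eqP: m0; rewrite /= /hasse_der derivX mulr1 (negbTE phi_neq0).
pose c := iter m1.+1 hasse_der 'X; pose G := iter m1 hasse_der 'X.
have c_neq0 : c != 0 by apply/negP => /minm; rewrite mE ltnn.
have c0 : c^`() = 0.
  have /eqP : hasse_der c = 0 by rewrite -m0 mE.
  by rewrite mulf_eq0 (negbTE phi_neq0) => /eqP.
have E : (3%:R * q ^+ p * G)^`() = q ^+ (2 * n) * c.
  have -> : c = phi * G^`() by [].
  have -> : q ^+ (2 * n) * (phi * G^`()) = 3%:R * q ^+ p * G^`().
    rewrite mulrA; congr (_ * _).
    by rewrite mulrCA -exprD; congr (_ * _ ^+ _); lia.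
  rewrite derivM derivM deriv_exp (mulrn_pchar_dvd charP _ (dvdnn p)) mulr0 addr0.
  by rewrite -polyC_natr derivC !mul0r add0r.
have pd : (p %| (size c).-1)%N.
  apply/negP => /negP /(deriv_eq0_coef c0) /eqP.
  by rewrite -/(lead_coef c) lead_coef_eq0 (negbTE c_neq0).
have := congr1 (fun f : {poly k} => f`_((size c).-1 + 3 * n)) E.
rewrite coef_deriv (mulrn_pchar_dvd charp); last by rewrite -addnS -pE dvdn_add.
have c_gt0 : (0 < size c)%N by rewrite size_poly_gt0.
rewrite mulrC coefM.
have ltc : ((size c).-1 < ((size c).-1 + 3 * n).+1)%N by rewrite ltnS leq_addr.
rewrite (bigD1 (Ordinal ltc)) //= big1 => [|[i /= i_lt] ic].
  rewrite addr0 addKn => /eqP; rewrite eq_sym mulf_eq0 lead_coef_eq0.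
  rewrite (negbTE c_neq0) /= exprMn coefXnM ltnNge leq_mul2r orbT /=.
  rewrite -mulnBl mul1n.
  by rewrite (negbTE central_coef_neq0).
(* The other terms vanish: an exponent i occurring in [c] is divisible by p, so below the top it is
   at most deg c - p. The matching exponent in [q ^+ (2 * n)] is then at least 3n + p, above the
   degree 4n. *)
have [ci|ci] := ltnP (size c).-1 i.
  by rewrite nth_default ?mul0r // -(prednK c_gt0).
have [pi|pi] := boolP (p %| i)%N; last by rewrite (deriv_eq0_coef c0) // mul0r.
have {}ci : (i < (size c).-1)%N.
  rewrite ltn_neqAle ci andbT; apply: contraNneq ic => ic.
  by apply/eqP/val_inj.
rewrite [X in _ * X]nth_default ?mulr0 // size_qX.
have /dvdn_leq : (p %| (size c).-1 - i)%N by rewrite dvdn_sub.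
rewrite subn_gt0 => /(_ ci); rewrite pE; move: (size c).-1 ci => s; clear; lia.
Qed.

Lemma hasse_der_iterp : exists a, a != 0 /\
  iter p hasse_der 'X = a *: q ^+ (p * n + n.+1).
Proof.
have [a aE] := hasse_der_iterp_const; exists a; split=> //.
by apply/eqP => a0; case/eqP: hasse_der_iterp_neq0; rewrite aE a0 scale0r.
Qed.

End OneVariable.

(** * Pulling the one-variable field back along a function *)

Section Pullback.

Variables (k : closedFieldType) (F : fieldType) (iota : {rmorphism k -> F}).
Variables (p n : nat) (D : F -> F).
Hypotheses (derD : is_der D) (D_iota : forall c, D (iota c) = 0).

Lemma der_horner (f : {poly k}) h :
  D (map_poly iota f).[h] = (map_poly iota f^`()).[h] * D h.
Proof.
elim/poly_ind: f => [|f c IH].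
  by rewrite deriv0 rmorph0 horner0 (der0 derD) mul0r.
rewrite derivD derivM derivX derivC addr0 mulr1.
rewrite !(rmorphD, rmorphM) /= map_polyX map_polyC !hornerE.
by rewrite (derA derD) (derM derD) IH D_iota addr0 mulrDl mulrAC.
Qed.

Hypotheses (charp : p \in [pchar k]) (pE : p = (3 * n).+1).

(** On polynomials in [h] the derivation [D] is [s] times [hasse_der], and [s] is a constant of
    [D]. *)
Lemma iter_pullback (s h : F) m : D s = 0 ->
  D h = s * (3%:R * (h * (h - 1)) ^+ n.+1) ->
  iter m D h = s ^+ m * (map_poly iota (iter m (@hasse_der k n) 'X)).[h].
Proof.
move=> s0 Dh; elim: m => [|m IH]; first by rewrite mul1r map_polyX hornerX.
rewrite !iterS IH (derM derD) (derX derD) s0 mulr0 mul0rn mul0r add0r.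
rewrite der_horner Dh [s ^+ m.+1]exprSr -[RHS]mulrA; congr (_ * _).
rewrite mulrCA; congr (_ * _).
rewrite {1}/hasse_der !(rmorphM, rmorphXn, rmorphB, rmorph_nat) /= rmorph1 map_polyX.
by rewrite mulrC 2!hornerM -(@polyC_natr F 3) hornerC -polyC1 !hornerE.
Qed.

(** The order of quantifiers matters: one [a] serves all pairs [s], [h], which allows the comparison
    of two functions. *)
Lemma pullback_iterp : exists a : k, a != 0 /\ forall s h, D s = 0 ->
  D h = s * (3%:R * (h * (h - 1)) ^+ n.+1) ->
  iter p D h = s ^+ p * (iota a * (h * (h - 1)) ^+ (p * n + n.+1)).
Proof.
have [a [a0 aE]] := hasse_der_iterp charp pE.
exists a; split=> // s h s0 Dh; rewrite (iter_pullback p s0 Dh) aE.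
rewrite -mul_polyC !(rmorphM, rmorphXn, rmorphB) /= rmorph1 map_polyX map_polyC.
by rewrite -polyC1 !hornerE.
Qed.

End Pullback.

(** * The p-curvature of the affine vector field *)

Section PCurvature.

Variables (k : closedFieldType) (F : fieldType) (iota : {rmorphism k -> F}).
Variables (p n : nat) (D : F -> F) (alpha : k) (x y : F).
Hypotheses (charp : p \in [pchar k]) (pE : p = (3 * n).+1).
Hypotheses (derD : is_der D) (D_iota : forall c, D (iota c) = 0).

Local Notation al := (iota alpha).

Hypotheses (Dx : D x = (x ^+ 3 - 1) * (x - al * y ^+ 2))
           (Dy : D y = (y ^+ 3 - 1) * (y - al * x ^+ 2)).
Hypotheses (alpha_neq0 : alpha != 0) (x_neq0 : x != 0) (y_neq0 : y != 0).
Hypotheses (x3_neq1 : x ^+ 3 - 1 != 0) (y3_neq1 : y ^+ 3 - 1 != 0)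
           (x3y3 : x ^+ 3 - y ^+ 3 != 0).

Let P := (x ^+ 3 - 1) * (y ^+ 3 - 1) * (x ^+ 3 - y ^+ 3).
Let h := (x ^+ 3 - 1) / (y ^+ 3 - 1).
Let h0 := (x ^+ 3 - 1) * y ^+ 3 / (x ^+ 3 * (y ^+ 3 - 1)).

Let der_h (E : F -> F) : is_der E ->
  E h = (3%:R * x ^+ 2 * E x - h * (3%:R * y ^+ 2 * E y)) / (y ^+ 3 - 1).
Proof.
move=> derE; have e1 : h * (y ^+ 3 - 1) = x ^+ 3 - 1 by rewrite /h divfK.
have := congr1 E e1.
rewrite (derM derE h) !(derB derE) !(derX derE) (der1 derE) !subr0 /= => e2.
apply: (mulIf y3_neq1); rewrite divfK // -[LHS](addrK (h * (y ^+ 2 * E y *+ 3))) e2.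
by ring.
Qed.

Let der_h0 (E : F -> F) : is_der E ->
  E h0 = (3%:R * x ^+ 2 * E x * y ^+ 3 + (x ^+ 3 - 1) * (3%:R * y ^+ 2 * E y) -
          h0 * (3%:R * x ^+ 2 * E x * (y ^+ 3 - 1) + x ^+ 3 * (3%:R * y ^+ 2 * E y)))
         / (x ^+ 3 * (y ^+ 3 - 1)).
Proof.
have xy0 : x ^+ 3 * (y ^+ 3 - 1) != 0 by rewrite mulf_neq0 ?expf_neq0.
move=> derE; have e1 : h0 * (x ^+ 3 * (y ^+ 3 - 1)) = (x ^+ 3 - 1) * y ^+ 3.
  by rewrite /h0 divfK.
have := congr1 E e1.
rewrite (derM derE h0) (derM derE (x ^+ 3)) (derM derE (x ^+ 3 - 1)).
rewrite !(derB derE) !(derX derE) (der1 derE) !subr0 /= => e2.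
apply: (mulIf xy0); rewrite divfK //.
rewrite -[LHS](addrK (h0 * (x ^+ 2 * E x *+ 3 * (y ^+ 3 - 1) +
  x ^+ 3 * (y ^+ 2 * E y *+ 3)))) e2.
by ring.
Qed.

Let D_h : D h = 3%:R * h * (x ^+ 3 - y ^+ 3).
Proof. by rewrite der_h // Dx Dy /h; field. Qed.

Let D_h0 : D h0 = 3%:R * al * h0 * (x ^+ 3 - y ^+ 3) / (x * y).
Proof. by rewrite der_h0 // Dx Dy /h0; field; rewrite ?x_neq0 ?y_neq0 ?y3_neq1. Qed.

Let P_h : P = h * (h - 1) * (y ^+ 3 - 1) ^+ 3.
Proof. by rewrite /P /h; field. Qed.

(** The counterpart for [h0] of the factor [y ^+ 3 - 1] in [P_h]. *)
Let e := x ^+ 2 * (y ^+ 3 - 1) / y.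

Let P_h0 : P = h0 * (h0 - 1) * e ^+ 3.
Proof. by rewrite /P /h0 /e; field; rewrite ?x_neq0 ?y_neq0 ?y3_neq1. Qed.

Let charF : p \in [pchar F].
Proof. by rewrite (fmorph_pchar iota). Qed.

Let P_neq0 : P != 0. Proof. by rewrite !mulf_neq0. Qed.

Let three_neq0 : 3%:R != 0 :> k.
Proof.
rewrite -(dvdn_pcharf charp); apply/negP => /dvdn_leq; move/(_ isT).
by case: (n) pE (pcharf_prime charp) => [|m] -> //; rewrite mulnS.
Qed.

Let threeF_neq0 : 3%:R != 0 :> F.
Proof. by rewrite -(rmorph_nat iota) fmorph_eq0. Qed.

Lemma p_curvature : exists a : k, a != 0 /\
  D x * iter p D y - D y * iter p D x = iota ((alpha - alpha ^+ p) * a) * P ^+ n.+1.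
Proof.
pose w f := P ^+ n * D f.
have derw : is_der w by apply: der_scale.
have w_iota c : w (iota c) = 0 by rewrite /w D_iota mulr0.
have [a [a0 wp]] := pullback_iterp derw w_iota charp pE.
(* The 3n factors y^3 - 1 in P^n and the one in x^3 - y^3 = (h - 1)(y^3 - 1) combine to a p-th
   power, hence a constant of [w]. For [h0] the same happens with [e]. *)
have wh : w h = (y ^+ 3 - 1) ^+ p * (3%:R * (h * (h - 1)) ^+ n.+1).
  rewrite /w D_h P_h exprMn -exprM pE [_ ^+ (3 * n).+1]exprS [_ ^+ n.+1]exprS.
  have -> : x ^+ 3 - y ^+ 3 = (h - 1) * (y ^+ 3 - 1) by rewrite /h; field.
  by ring.
have wh0 : w h0 = al * e ^+ p * (3%:R * (h0 * (h0 - 1)) ^+ n.+1).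
  rewrite /w D_h0 P_h0 exprMn -exprM pE [_ ^+ (3 * n).+1]exprS [_ ^+ n.+1]exprS.
  rewrite -[_ / (x * y)]mulrA.
  have -> : (x ^+ 3 - y ^+ 3) / (x * y) = (h0 - 1) * e.
    by rewrite /h0 /e; field; rewrite ?x_neq0 ?y_neq0 ?y3_neq1.
  by ring.
have sh : w ((y ^+ 3 - 1) ^+ p) = 0 by rewrite (der_expp derw charF).
have sh0 : w (al * e ^+ p) = 0.
  by rewrite (derM derw) (der_expp derw charF) w_iota mul0r mulr0 addr0.
have {}wph := wp _ _ sh wh; have {}wph0 := wp _ _ sh0 wh0.
have [g gE] := iter_scaled_der (P ^+ n) charF derD.
have pow c : (c ^+ p) ^+ p = (c ^+ 3) ^+ (n * p) * c ^+ p :> F.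
  by rewrite -!exprM -exprD; congr (_ ^+ _); rewrite mulnA -mulSnr -pE.
(* Thus w^p multiplies w(h) by (a/3) P^(np), but w(h0) by al^(p-1) (a/3) P^(np), since [s] contains
   al and enters w^p(h0) as s^p. This discrepancy is the source of the factor alpha - alpha^p. *)
have {}wph : 3%:R * iter p w h = iota a * (P ^+ n) ^+ p * w h.
  rewrite wph wh pow -(exprM P) P_h [(h * (h - 1) * _) ^+ _]exprMn exprD.
  rewrite (mulnC p n).
  by ring.
have {}wph0 : 3%:R * al * iter p w h0 = al ^+ p * iota a * (P ^+ n) ^+ p * w h0.
  rewrite wph0 wh0 exprMn pow -(exprM P) P_h0 [(h0 * (h0 - 1) * _) ^+ _]exprMn.
  rewrite exprD (mulnC p n).
  by ring.
rewrite gE /w in wph; rewrite gE /w in wph0.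
have derDp := der_iterp derD charF.
set W := _ - _.
(* The Jacobian of (h, h0) with respect to (x, y). *)
pose J := 9%:R * h * h0 * (y ^+ 3 - x ^+ 3) / (x * y * (x ^+ 3 - 1) * (y ^+ 3 - 1)).
have JW : D h * iter p D h0 - D h0 * iter p D h = J * W.
  rewrite !der_h ?der_h0 // /W /J /h /h0.
  by field; rewrite ?x_neq0 ?y_neq0 ?y3_neq1 ?x3_neq1.
have Q0 : (P ^+ n) ^+ p != 0 by rewrite !expf_neq0.
have al0 : al != 0 by rewrite fmorph_eq0.
have hh0 : h != 0 by rewrite mulf_neq0 ?invr_eq0.
have hh00 : h0 != 0 by rewrite !mulf_neq0 ?invr_eq0 ?mulf_neq0 ?expf_neq0.
(* The unknown [g] of Hochschild's formula cancels in the determinant of [D] and its p-th iterate on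
   [h], [h0]. *)
have E : 3%:R * al * (J * W) = (al ^+ p - al) * iota a * P ^+ n * (D h * D h0).
  apply: (mulfI Q0); rewrite -JW.
  have -> : (P ^+ n) ^+ p * (3%:R * al * (D h * iter p D h0 - D h0 * iter p D h)) =
    D h * (3%:R * al * ((P ^+ n) ^+ p * iter p D h0 + g * D h0)) -
    al * D h0 * (3%:R * ((P ^+ n) ^+ p * iter p D h + g * D h)) by ring.
  by rewrite wph wph0; ring.
have nine : 9%:R = 3%:R * 3%:R :> F by rewrite -natrM.
have J0 : 3%:R * al * J != 0.
  rewrite /J nine !mulf_neq0 ?invr_eq0 ?mulf_neq0 //.
  by rewrite -opprB oppr_eq0.
(* Since D h * D h0 = - al * J * P, cancelling [3%:R * al * J] in [E] leaves the constant a/3. *)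
exists (a / 3%:R); split; first by rewrite mulf_neq0 ?invr_eq0.
apply: (mulfI J0); rewrite -[LHS]mulrA E D_h D_h0 /J [P ^+ n.+1]exprS.
move: (P ^+ n) => Q; rewrite /P.
rewrite !(rmorphM, rmorphB, rmorphXn, fmorphV, rmorph_nat) /=.
by field; rewrite ?x_neq0 ?y_neq0 ?y3_neq1 ?x3_neq1 ?threeF_neq0.
Qed.

End PCurvature.

(** * Divisibility in multivariate polynomial rings *)

Lemma mpoly_ring_ind (n : nat) (R : comNzRingType) (Q : {mpoly R[n]} -> Prop) :
  (forall c, Q c%:MP) -> (forall i, Q 'X_i) ->
  (forall f g, Q f -> Q g -> Q (f + g)) ->
  (forall f g, Q f -> Q g -> Q (f * g)) -> forall f, Q f.
Proof.
move=> QC QX QD QM; elim/mpolyind => [|c m f _ _ IH].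
  by rewrite -mpolyC0; apply: QC.
apply: (QD) => //; rewrite -mul_mpolyC; apply: (QM); first exact: QC.
rewrite mpolyXE_id; apply: (big_ind Q) => [||j _].
- by rewrite -mpolyC1; apply: QC.
- exact: QM.
elim: (m j) => [|d IHd]; first by rewrite expr0 -mpolyC1; apply: QC.
by rewrite exprS; apply: QM.
Qed.

Lemma mderiv_var (n : nat) (R : comNzRingType) (i j : 'I_n) :
  ('X_j : {mpoly R[n]})^`M(i) = (i == j)%:R.
Proof.
rewrite mderivX mnm1E eq_sym; case: eqP => [->|]; last by rewrite scale0r.
by rewrite scale1r -[X in (X - _)%MM]add0m addmK mpolyX0.
Qed.

Section Divisibility.

Variables (n : nat) (R : idomainType).
Implicit Types f g h l : {mpoly R[n]}.

Lemma mdivides_refl f : mdivides f f.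
Proof. by exists 1; rewrite mul1r. Qed.

Lemma mdivides_mull f g h : mdivides f g -> mdivides f (h * g).
Proof. by case=> q ->; exists (h * q); rewrite mulrA. Qed.

Lemma mdivides_mulr f g h : mdivides f g -> mdivides f (g * h).
Proof. by rewrite mulrC; apply: mdivides_mull. Qed.

Lemma mdividesD f g h : mdivides f g -> mdivides f h -> mdivides f (g + h).
Proof. by move=> [a ->] [b ->]; exists (a + b); rewrite mulrDl. Qed.

Lemma mdividesN f g : mdivides f g -> mdivides f (- g).
Proof. by move=> [a ->]; exists (- a); rewrite mulNr. Qed.

Lemma mdividesB f g h : mdivides f g -> mdivides f h -> mdivides f (g - h).
Proof. by move=> fg fh; apply: mdividesD => //; apply: mdividesN. Qed.

Lemma mdivides_trans f g h : mdivides f g -> mdivides g h -> mdivides f h.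
Proof. by move=> [a ->] [b ->]; exists (b * a); rewrite mulrA. Qed.

(** Primality in the sense of divisibility. The primes that occur below are, up to units, of the
    form ['X_i - q]. *)
Definition mprime l : Prop := l \isn't a GRing.unit /\
  forall f g, mdivides l (f * g) -> mdivides l f \/ mdivides l g.

Lemma mprime_exp l f m : mprime l -> mdivides l (f ^+ m) -> mdivides l f.
Proof.
move=> [l_nu lP]; elim: m => [[h /esym hl]|m IH].
  case/negP: l_nu; apply/unitrP; exists h.
  by rewrite hl [l * h]mulrC hl.
by rewrite exprS => /lP[].
Qed.

Lemma mprime_unitl l u : u \is a GRing.unit -> mprime l -> mprime (u * l).
Proof.
move=> uU [l_nu lP]; split; first by rewrite unitrM uU.
have ul f : mdivides (u * l) f <-> mdivides l f.
  split=> [|[h ->]]; first by apply: mdivides_trans; exists u.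
  by exists (h / u); rewrite mulrA divrK.
by move=> f g /ul /lP; rewrite !ul.
Qed.

(** Each prime divides [f] or its cofactor; in the latter case it is cancelled and the induction
    continues. *)
Lemma prod_mprime_dvd (s : seq {mpoly R[n]}) f g :
  (forall l, l \in s -> l != 0 /\ mprime l) ->
  mdivides f (\prod_(l <- s) l * g) ->
  (exists2 l, l \in s & mdivides l f) \/ mdivides f g.
Proof.
elim: s f => [|l s IH] f sP; first by rewrite big_nil mul1r; right.
rewrite big_cons -mulrA => -[h hE].
have [l0 [l_nu lP]] := sP l (mem_head _ _).
have [|[h' h'E]|lf] := lP h f.
- by rewrite -hE; apply: mdivides_mulr; apply: mdivides_refl.
- have [||[l' l's l'f]|fg] := IH f.
  + by move=> l' l's; apply: sP; rewrite inE l's orbT.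
  + exists h'; apply: (mulfI l0); rewrite hE h'E.
    by rewrite -mulrA mulrCA.
  + by left; exists l' => //; rewrite inE l's orbT.
  + by right.
- by left; exists l; rewrite ?mem_head.
Qed.

Lemma prod_mprime_coprime (s : seq {mpoly R[n]}) f g :
  (forall l, l \in s -> [/\ l != 0, mprime l & ~ mdivides l f]) ->
  mdivides (\prod_(l <- s) l) (f * g) -> mdivides (\prod_(l <- s) l) g.
Proof.
elim: s g => [|l s IH] g sP; first by exists g; rewrite big_nil mulr1.
rewrite big_cons => -[h hE].
have [l0 [_ lP] lf] := sP l (mem_head _ _).
have [|//|[g' gE]] := lP f g; first by exists (h * \prod_(j <- s) j); rewrite hE; ring.
have [||h' h'E] := IH g'.
- by move=> l' l's; apply: sP; rewrite inE l's orbT.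
- by exists h; apply: (mulfI l0); rewrite mulrCA [l * g']mulrC -gE hE; ring.
by exists h'; rewrite gE h'E; ring.
Qed.

Section Substitution.

Variables (i : 'I_n) (q : {mpoly R[n]}).

Definition subst f := f \mPo [tuple if j == i then q else 'X_j | j < n].

Lemma substX j : subst 'X_j = if j == i then q else 'X_j.
Proof. by rewrite /subst comp_mpolyXU -tnth_nth tnth_mktuple. Qed.

Lemma substM f g : subst (f * g) = subst f * subst g.
Proof. exact: rmorphM. Qed.

Lemma substD f g : subst (f + g) = subst f + subst g.
Proof. exact: rmorphD. Qed.

Lemma substB f g : subst (f - g) = subst f - subst g.
Proof. exact: rmorphB. Qed.

Lemma substC c : subst c%:MP = c%:MP.
Proof. exact: comp_mpolyC. Qed.

Lemma subst1 : subst 1 = 1.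
Proof. exact: rmorph1. Qed.

Lemma substXn f m : subst (f ^+ m) = subst f ^+ m.
Proof. exact: rmorphXn. Qed.

Lemma subst_congr f : mdivides ('X_i - q) (f - subst f).
Proof.
elim/mpoly_ring_ind: f => [c|j|f g Qf Qg|f g Qf Qg].
- by exists 0; rewrite substC subrr mul0r.
- rewrite substX; case: eqP => [->|_]; first exact: mdivides_refl.
  by exists 0; rewrite subrr mul0r.
- by rewrite substD opprD addrACA; apply: mdividesD.
rewrite substM.
have -> : f * g - subst f * subst g = (f - subst f) * g + subst f * (g - subst g).
  by rewrite mulrBl mulrBr addrA subrK.
by apply: mdividesD; [apply: mdivides_mulr|apply: mdivides_mull].
Qed.

Hypothesis subst_q : subst q = q.

(** By [subst_q] the substitution is idempotent, so its kernel is generated by ['X_i - q]. *)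
Lemma dvd_subst f : mdivides ('X_i - q) f <-> subst f = 0.
Proof.
split=> [[h ->]|f0]; last by rewrite -[f]subr0 -f0; apply: subst_congr.
by rewrite substM substB substX eqxx subst_q subrr mulr0.
Qed.

(** The kernel of a ring homomorphism into a domain is a prime ideal. *)
Lemma mprime_subst : mprime ('X_i - q).
Proof.
split.
  apply/negP => /unitrP[h [hE _]].
  have : subst (h * ('X_i - q)) = 0 by apply/dvd_subst; exists h.
  by rewrite hE -mpolyC1 substC => /eqP; rewrite mpolyC_eq0 oner_eq0.
move=> f g /dvd_subst; rewrite substM => /eqP.
by rewrite mulf_eq0 => /orP[] /eqP /dvd_subst; [left|right].
Qed.

End Substitution.

End Divisibility.

(** * The vector field on the affine plane *)

Section AffineField.

Variables (k : closedFieldType) (alpha : k).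

Local Notation X := ('X_0 : {mpoly k[2]}).
Local Notation Y := ('X_1 : {mpoly k[2]}).

Definition vx : {mpoly k[2]} := (X ^+ 3 - 1) * (X - alpha%:MP * Y ^+ 2).
Definition vy : {mpoly k[2]} := (Y ^+ 3 - 1) * (Y - alpha%:MP * X ^+ 2).
Definition vfield (f : {mpoly k[2]}) : {mpoly k[2]} :=
  vx * f^`M(0) + vy * f^`M(1).
Definition nine_affine : {mpoly k[2]} :=
  (X ^+ 3 - 1) * (Y ^+ 3 - 1) * (X ^+ 3 - Y ^+ 3).

Lemma vfield_der : is_der vfield.
Proof.
split=> f g; first by rewrite /vfield !mderivD; ring.
by rewrite /vfield !mderivM; ring.
Qed.

Lemma vfieldX : vfield X = vx.
Proof. by rewrite /vfield !mderiv_var /= mulr1 mulr0 addr0. Qed.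

Lemma vfieldY : vfield Y = vy.
Proof. by rewrite /vfield !mderiv_var /= mulr1 mulr0 add0r. Qed.

Lemma vfieldC c : vfield c%:MP = 0.
Proof. by rewrite /vfield !mderivC !mulr0 addr0. Qed.

Lemma meval_neq0 n (f : {mpoly k[n]}) (v : 'I_n -> k) : f.@[v] != 0 -> f != 0.
Proof. by apply: contraNneq => ->; rewrite meval0. Qed.

Variables (p n : nat).
Hypotheses (charp : p \in [pchar k]) (pE : p = (3 * n).+1) (alpha_neq0 : alpha != 0).

(** This is [p_curvature] in the function field of the plane; both sides are polynomials, so the
    identity descends. *)
Lemma wedge_vfield : exists a : k, a != 0 /\
  wedge vfield (iter p vfield) =
    ((alpha - alpha ^+ p) * a)%:MP * nine_affine ^+ n.+1.
Proof.
pose iota : {rmorphism k -> {fraction {mpoly k[2]}}} :=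
  (@FracField.tofrac _) \o (@mpolyC 2 k).
have derD := der_fracP vfield_der.
(* The points (1, 0) for [true] and (0, 1) for [false]; each element that must be nonzero is nonzero
   at one of them. *)
pose pt (b : bool) (i : 'I_2) : k := ((i == 0) == b)%:R.
have evX v i : ('X_i : {mpoly k[2]}).@[v] = v i by exact: mevalXU.
have nz (f : {mpoly k[2]}) b : f.@[pt b] != 0 -> f%:F != 0.
  by rewrite tofrac_eq0; apply: meval_neq0.
have [|||||||||a [a0 aE]] :=
    @p_curvature k _ iota p n (der_frac vfield) alpha X%:F Y%:F charp pE derD.
- by move=> c; rewrite der_fracF ?vfieldC ?tofrac0 //; apply: vfield_der.
- rewrite der_fracF; last exact: vfield_der.
  by rewrite vfieldX /iota /= -!(tofracXn, tofracM, tofracB, tofrac1).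
- rewrite der_fracF; last exact: vfield_der.
  by rewrite vfieldY /iota /= -!(tofracXn, tofracM, tofracB, tofrac1).
- by [].
- by apply: (nz _ true); rewrite evX /pt oner_neq0.
- by apply: (nz _ false); rewrite evX /pt oner_neq0.
- rewrite -tofracXn -tofrac1 -tofracB; apply: (nz _ false).
  by rewrite mevalB meval1 rmorphXn /= evX /pt expr0n sub0r oppr_eq0 oner_neq0.
- rewrite -tofracXn -tofrac1 -tofracB; apply: (nz _ true).
  by rewrite mevalB meval1 rmorphXn /= evX /pt expr0n sub0r oppr_eq0 oner_neq0.
- rewrite -!tofracXn -tofracB; apply: (nz _ true).
  by rewrite mevalB !rmorphXn /= !evX /pt expr0n expr1n subr0 oner_neq0.
exists a; split=> //; move: aE.
rewrite !(iter_der_frac vfield_der) !(der_fracF vfield_der) /iota /=.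
rewrite -!(tofracXn, tofracM, tofracB, tofrac1) => /eqP.
by rewrite tofrac_eq => /eqP.
Qed.

End AffineField.

(** * Charts and homogenization *)

Lemma ord2_neq (m m' : 'I_2) : m != m' ->
  (m = 0 /\ m' = 1) \/ (m = 1 /\ m' = 0).
Proof.
case: m m' => [[|[|//]] m2] [[|[|//]] m'2] // _; [left|right];
  by split; apply/val_inj.
Qed.

Lemma ord3_ind (Q : 'I_3 -> Prop) : Q 0 -> Q 1 -> Q 2 -> forall i, Q i.
Proof.
move=> Q0 Q1 Q2 [[|[|[|//]]] i3].
- by rewrite (_ : Ordinal i3 = 0) //; apply/val_inj.
- by rewrite (_ : Ordinal i3 = 1) //; apply/val_inj.
- by rewrite (_ : Ordinal i3 = 2) //; apply/val_inj.
Qed.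

Section Charts.

Variables (k : closedFieldType) (i : 'I_3).
Implicit Types f g : {mpoly k[3]}.

Lemma dehomD f g : dehom i (f + g) = dehom i f + dehom i g.
Proof. exact: rmorphD. Qed.

Lemma dehomN f : dehom i (- f) = - dehom i f.
Proof. exact: rmorphN. Qed.

Lemma dehomM f g : dehom i (f * g) = dehom i f * dehom i g.
Proof. exact: rmorphM. Qed.

Lemma dehomXn f n : dehom i (f ^+ n) = dehom i f ^+ n.
Proof. exact: rmorphXn. Qed.

Lemma dehomC (c : k) : dehom i c%:MP = c%:MP.
Proof. exact: comp_mpolyC. Qed.

Lemma dehom_prod (s : seq {mpoly k[3]}) :
  dehom i (\prod_(f <- s) f) = \prod_(f <- [seq dehom i f | f <- s]) f.
Proof. by rewrite big_map /dehom rmorph_prod. Qed.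

Lemma dehomE j :
  dehom i ('X_j : {mpoly k[3]}) = if unlift i j is Some m then 'X_m else 1.
Proof. by rewrite /dehom comp_mpolyXU -tnth_nth tnth_mktuple. Qed.

Lemma dehom_var : dehom i ('X_i : {mpoly k[3]}) = 1.
Proof. by rewrite dehomE unlift_none. Qed.

Lemma dehom_lift m : dehom i ('X_(lift i m) : {mpoly k[3]}) = 'X_m.
Proof. by rewrite dehomE liftK. Qed.

Lemma dehom_deriv f m : (dehom i f)^`M(m) = dehom i f^`M(lift i m).
Proof.
elim/mpoly_ring_ind: f => [c|j|f g Hf Hg|f g Hf Hg].
- by rewrite dehomC !mderivC -mpolyC0 dehomC.
- rewrite mderiv_var -mpolyC_nat dehomC mpolyC_nat dehomE.
  case: unliftP => [m' ->|->]; first by rewrite mderiv_var (inj_eq lift_inj).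
  by rewrite -mpolyC1 mderivC eq_sym (negbTE (neq_lift _ _)).
- by rewrite dehomD !mderivD dehomD Hf Hg.
- by rewrite dehomM !mderivM dehomD !dehomM Hf Hg.
Qed.

(** The affine coordinates as rational functions on the projective plane; up to a power of X_i this
    inverts [dehom] on forms. *)
Definition rehom : {mpoly k[2]} -> {fraction {mpoly k[3]}} :=
  mmap ((@FracField.tofrac _) \o (@mpolyC 3 k))
       (fun m => ('X_(lift i m))%:F / ('X_i)%:F).

Let Xi_neq0 : ('X_i : {mpoly k[3]})%:F != 0.
Proof.
rewrite tofrac_eq0; apply/eqP => /(congr1 (meval (fun=> 1))).
by rewrite mevalXU meval0 => /eqP; rewrite oner_eq0.
Qed.

Lemma rehomM a b : rehom (a * b) = rehom a * rehom b.
Proof. exact: rmorphM. Qed.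

Lemma rehomD a b : rehom (a + b) = rehom a + rehom b.
Proof. exact: rmorphD. Qed.

Lemma rehomC c : rehom c%:MP = (c%:MP)%:F.
Proof. exact: mmapC. Qed.

Lemma rehomX m : rehom 'X_m = ('X_(lift i m))%:F / ('X_i)%:F.
Proof. by rewrite /rehom mmapX mmap1U. Qed.

Lemma rehom_dehomX j : rehom (dehom i ('X_j : {mpoly k[3]})) = ('X_j)%:F / ('X_i)%:F.
Proof.
rewrite dehomE; case: unliftP => [m ->|->]; first exact: rehomX.
by rewrite -mpolyC1 rehomC mpolyC1 tofrac1 divff.
Qed.

Lemma rehomK d f : f \is d.-homog -> f%:F = ('X_i)%:F ^+ d * rehom (dehom i f).
Proof.
move=> /dhomogP fh.
have E m : ('X_i)%:F ^+ mdeg m * rehom (dehom i 'X_[m]) = ('X_[m] : {mpoly k[3]})%:F.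
  rewrite (mpolyXE_id _ m) /dehom /rehom !rmorph_prod mdegE -prodrXr -big_split /=.
  apply: eq_bigr => j _; rewrite !rmorphXn -exprMn; congr (_ ^+ _).
  rewrite -[LHS]/(('X_i)%:F * rehom (dehom i ('X_j : {mpoly k[3]}))).
  by rewrite rehom_dehomX mulrC divfK.
pose phi g := rehom (dehom i g).
have phiD : {morph phi : u v / u + v} by move=> u v; rewrite /phi dehomD rehomD.
have phi0 : phi 0 = 0 by rewrite /phi -mpolyC0 dehomC rehomC mpolyC0 tofrac0.
rewrite -/(phi f) [f]mpolyE (big_morph phi phiD phi0).
rewrite (big_morph _ (@tofracD _) (@tofrac0 _)) mulr_sumr.
apply: eq_big_seq => m mf; rewrite -mul_mpolyC /phi dehomM rehomM dehomC rehomC.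
by rewrite tofracM -E (fh m mf) mulrCA.
Qed.

Lemma rehom_denom h : exists N g, ('X_i)%:F ^+ N * rehom h = g%:F.
Proof.
elim/mpoly_ring_ind: h => [c|m|a b [N [g E]] [N' [g' E']]|a b [N [g E]] [N' [g' E']]].
- by exists 0%N, c%:MP; rewrite rehomC mul1r.
- by exists 1%N, 'X_(lift i m); rewrite rehomX mulrC divfK.
- exists (N + N')%N, ('X_i ^+ N' * g + 'X_i ^+ N * g').
  rewrite rehomD tofracD !tofracM !tofracXn -E -E' mulrDr exprD.
  by congr (_ + _); rewrite ?mulrA // [X in X * _]mulrC.
- exists (N + N')%N, (g * g').
  by rewrite rehomM tofracM -E -E' exprD mulrACA.
Qed.

Lemma dehom_const d f c : f \is d.-homog -> dehom i f = c%:MP ->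
  f = c%:MP * 'X_i ^+ d.
Proof.
move=> /rehomK fE fc; apply/eqP.
by rewrite -tofrac_eq fE fc rehomC tofracM tofracXn mulrC.
Qed.

Lemma dehom_eq0 d f : f \is d.-homog -> dehom i f = 0 -> f = 0.
Proof.
move=> fh f0; rewrite (dehom_const (c := 0) fh) ?mpolyC0 ?mul0r //.
Qed.

(** The homogenized cofactor has a power of X_i as denominator; clearing it creates the factor
    X_i^N. *)
Lemma dehom_dvd d e f g : f \is d.-homog -> g \is e.-homog ->
  mdivides (dehom i f) (dehom i g) -> exists N, mdivides f ('X_i ^+ N * g).
Proof.
move=> /rehomK fE /rehomK gE [h hE].
have [N [h' h'E]] := rehom_denom h; exists (d + N)%N, (h' * 'X_i ^+ e).
apply/eqP; rewrite -tofrac_eq !tofracM !tofracXn -h'E fE gE hE rehomM exprD.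
have E (F : comNzRingType) (a b c u v : F) : a * b * (c * (u * v)) = b * u * c * (a * v).
  by ring.
by apply/eqP; exact: E.
Qed.

End Charts.

Section ChartVariables.

Variable k : closedFieldType.
Local Notation Z j := ('X_j : {mpoly k[3]}).

Let lift_vals : [/\ lift (0 : 'I_3) 0 = 1, lift (0 : 'I_3) 1 = 2 &
  [/\ lift (1 : 'I_3) 0 = 0, lift (1 : 'I_3) 1 = 2,
      lift (2 : 'I_3) 0 = 0 & lift (2 : 'I_3) 1 = 1]].
Proof. by do 2?split; apply/val_inj. Qed.

Lemma dehom_chart0 : [/\ dehom 0 (Z 0) = 1, dehom 0 (Z 1) = 'X_0 & dehom 0 (Z 2) = 'X_1].
Proof.
case: lift_vals => e0 e1 _.
by rewrite dehom_var -[in Z 1]e0 -[in Z 2]e1 !dehom_lift.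
Qed.

Lemma dehom_chart1 : [/\ dehom 1 (Z 0) = 'X_0, dehom 1 (Z 1) = 1 & dehom 1 (Z 2) = 'X_1].
Proof.
case: lift_vals => _ _ [e0 e1 _ _].
by rewrite dehom_var -[in Z 0]e0 -[in Z 2]e1 !dehom_lift.
Qed.

Lemma dehom_chart2 : [/\ dehom 2 (Z 0) = 'X_0, dehom 2 (Z 1) = 'X_1 & dehom 2 (Z 2) = 1].
Proof.
case: lift_vals => _ _ [_ _ e0 e1].
by rewrite dehom_var -[in Z 0]e0 -[in Z 1]e1 !dehom_lift.
Qed.

End ChartVariables.

(** * The nine lines *)

Lemma mpoly_unitP (k : fieldType) n (u : {mpoly k[n]}) :
  u \is a GRing.unit -> exists2 c, c != 0 & u = c%:MP.
Proof.
by case/andP=> /eqP uE; rewrite unitfE => c0; exists u@_0.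
Qed.

Lemma mpolyC_unit (k : fieldType) n (c : k) :
  c != 0 -> (c%:MP : {mpoly k[n]}) \is a GRing.unit.
Proof.
move=> c0; apply/unitrP; exists c^-1%:MP.
by rewrite -!mpolyCM mulVf // mulfV.
Qed.

Lemma nine_affine_neq0 (k : closedFieldType) : nine_affine k != 0.
Proof.
have evX v i : ('X_i : {mpoly k[2]}).@[v] = v i by exact: mevalXU.
have cube0 i : ('X_i : {mpoly k[2]}) ^+ 3 - 1 != 0.
  apply: (@meval_neq0 _ _ _ (fun=> 0)).
  by rewrite mevalB meval1 rmorphXn /= evX ?expr0n ?mul0r sub0r oppr_eq0 oner_neq0.
rewrite !mulf_neq0 //; apply: (@meval_neq0 _ _ _ (fun j => (j == 0)%:R)).
by rewrite mevalB !rmorphXn /= !evX ?expr0n ?expr1n ?mul0r subr0 ?mulr1 oner_neq0.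
Qed.

Lemma primitive_cube_root (k : closedFieldType) :
  exists w : k, w ^+ 2 + w + 1 = 0.
Proof.
have [|w] := closed_rootP (('X + 1%:P) * 'X + 1%:P : {poly k}) _.
  by rewrite size_MXaddC oner_eq0 andbF size_XaddC.
rewrite rootE !hornerE => /eqP E; exists w.
by rewrite -[RHS]E; ring.
Qed.

Section Lines.

Variables (k : closedFieldType) (w : k).
Hypothesis w_root : w ^+ 2 + w + 1 = 0.

(** The last entry is w^2, by [w_root]. *)
Definition cube_roots : seq k := [:: 1; w; - 1 - w].

Lemma cube_rootsP z : z \in cube_roots -> z ^+ 3 = 1.
Proof.
have w2 : w ^+ 2 = - 1 - w.
  by apply/eqP; rewrite -subr_eq0 -w_root; apply/eqP; ring.
have w3 : w ^+ 3 = 1 by rewrite exprS w2 mulrDr mulrN mulr1 mulrN -expr2 w2; ring.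
rewrite !inE => /or3P[] /eqP->; rewrite ?expr1n //.
by rewrite -w2 -exprM mulnC exprM w3 expr1n.
Qed.

Lemma subr3_factor m (u v : {mpoly k[m]}) :
  u ^+ 3 - v ^+ 3 = \prod_(z <- cube_roots) (u - z%:MP * v).
Proof.
have W : (w%:MP : {mpoly k[m]}) ^+ 2 + w%:MP + 1 = 0.
  by rewrite -mpolyC1 -rmorphXn /= -!mpolyCD w_root mpolyC0.
rewrite !big_cons big_nil mulr1 mpolyCB mpolyCN mpolyC1.
set W' := w%:MP in W *.
have -> : (u - 1 * v) * ((u - W' * v) * (u - (- 1 - W') * v)) =
  (u - v) * (u ^+ 2 + u * v - (W' ^+ 2 + W' + 1) * v ^+ 2 + v ^+ 2) by ring.
by rewrite W; ring.
Qed.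

Definition line (a b : 'I_3) (z : k) : {mpoly k[3]} := 'X_a - z%:MP * 'X_b.

Definition lines : seq {mpoly k[3]} :=
  [seq line 0 1 z | z <- cube_roots] ++
  [seq line 1 2 z | z <- cube_roots] ++ [seq line 2 0 z | z <- cube_roots].

Definition nine_form : {mpoly k[3]} :=
  ('X_0 ^+ 3 - 'X_1 ^+ 3) * ('X_1 ^+ 3 - 'X_2 ^+ 3) * ('X_2 ^+ 3 - 'X_0 ^+ 3).

Lemma nine_form_lines : nine_form = \prod_(l <- lines) l.
Proof. by rewrite /nine_form !subr3_factor !big_cat !big_map /= mulrA. Qed.

Lemma linesP l : l \in lines ->
  exists a b z, [/\ a != b, z ^+ 3 = 1 & l = line a b z].
Proof.
rewrite !mem_cat => /or3P[] /mapP[z /cube_rootsP z3 ->].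
- by exists 0, 1, z.
- by exists 1, 2, z.
- by exists 2, 0, z.
Qed.

Lemma line_homog a b z : line a b z \is 1.-homog.
Proof.
have X1 (i : 'I_3) : ('X_i : {mpoly k[3]}) \is 1.-homog.
  by rewrite dhomogX; apply/eqP; apply: mdeg1.
by rewrite /line mul_mpolyC rpredB // rpredZ.
Qed.

Lemma line_subst a b z : a != b -> subst a (z%:MP * 'X_b) (z%:MP * 'X_b) =
  z%:MP * 'X_b :> {mpoly k[3]}.
Proof. by move=> ab; rewrite substM substC substX eq_sym (negbTE ab). Qed.

Lemma mprime_line a b z : a != b -> mprime (line a b z).
Proof. by move=> ab; apply: mprime_subst; apply: line_subst. Qed.

Lemma line_ndvd_var a b z i : a != b -> z != 0 -> ~ mdivides (line a b z) 'X_i.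
Proof.
move=> ab z0 /(dvd_subst (line_subst z ab)); rewrite substX => /eqP.
have X0 j : ('X_j : {mpoly k[3]}) != 0.
  by apply: (@meval_neq0 _ _ _ (fun=> 1)); rewrite mevalXU oner_neq0.
by case: ifP => _; rewrite ?mulf_eq0 ?mpolyC_eq0 ?(negbTE z0) (negbTE (X0 _)).
Qed.

(* The affine lines that are traces of the nine lines in a chart. *)
Definition affine_line (l : {mpoly k[2]}) : Prop :=
  exists m m' z, [/\ m != m', z ^+ 3 = 1 &
    l = 'X_m - z%:MP \/ l = 'X_m - z%:MP * 'X_m'].

Lemma cube_neq0 (z : k) : z ^+ 3 = 1 -> z != 0.
Proof.
by move=> z3; apply/eqP => z0; move/eqP: z3; rewrite z0 expr0n eq_sym oner_eq0.
Qed.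

Lemma dehom_line i a b z : a != b -> z ^+ 3 = 1 ->
  exists c m, [/\ c != 0, affine_line m & dehom i (line a b z) = c%:MP * m].
Proof.
move=> ab z3; have z0 := cube_neq0 z3.
have oth (m : 'I_2) : exists m' : 'I_2, m != m'.
  by case: (eqVneq m 0) => [->|m0]; [exists 1 | exists 0].
rewrite /line -[- (_ * _)]mulNr -mpolyCN dehomD dehomM dehomC.
have [iE|ia] := eqVneq i a.
  rewrite -iE in ab *.
  have /unlift_some[m bE _] := ab.
  have [m' mm'] := oth m.
  (* As z^3 = 1, the trace 1 - z X_m equals - z (X_m - z^2). *)
  exists (- z), ('X_m - (z ^+ 2)%:MP); split; first by rewrite oppr_eq0.
    exists m, m', (z ^+ 2); split=> //; last by left.
    by rewrite -exprM mulnC exprM z3 expr1n.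
  have z3P : (z%:MP : {mpoly k[2]}) ^+ 3 = 1 by rewrite -rmorphXn /= z3 mpolyC1.
  rewrite dehom_var bE dehom_lift -[1]z3P mpolyCN rmorphXn /=.
  by ring.
have /unlift_some[m aE _] := ia.
exists 1; have [iE|ib] := eqVneq i b.
  rewrite -iE.
  have [m' mm'] := oth m; exists ('X_m - z%:MP).
  split; [exact: oner_neq0|by exists m, m', z; split=> //; left|].
  by rewrite dehom_var aE dehom_lift mulr1 mpolyC1 mul1r mpolyCN.
have /unlift_some[m' bE _] := ib; exists ('X_m - z%:MP * 'X_m').
split; [exact: oner_neq0| |].
  exists m, m', z; split=> //; last by right.
  by apply: contraNneq ab => mm'; rewrite aE bE mm'.
by rewrite aE bE !dehom_lift mpolyC1 mul1r mpolyCN mulNr.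
Qed.

Lemma mprime_affine_line l : affine_line l -> l != 0 /\ mprime l.
Proof.
case=> m [m' [z [mm' z3 lE]]].
split; last first.
  case: lE => ->; apply: mprime_subst; first exact: substC.
  by rewrite substM substC substX eq_sym (negbTE mm').
case: lE => ->.
  apply: (@meval_neq0 _ _ _ (fun=> z + 1)).
  by rewrite mevalB mevalXU mevalC addrC addKr oner_neq0.
apply: (@meval_neq0 _ _ _ (fun j => (j == m)%:R)).
rewrite mevalB mevalM !mevalXU eqxx [m' == m]eq_sym (negbTE mm') mulr0 subr0.
exact: oner_neq0.
Qed.

Variable alpha : k.

Lemma cube_sub (R : comNzRingType) (u v : R) :
  u ^+ 3 - v ^+ 3 = (u - v) * (u ^+ 2 + u * v + v ^+ 2).
Proof. by ring. Qed.

(** For X_m - z, the derivative contains the factor X_m^3 - 1 = X_m^3 - z^3. For X_m - z X_m', its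
    restriction to the line is a multiple of z^3 - 1. *)
Lemma affine_line_invariant l : affine_line l -> mdivides l (vfield alpha l).
Proof.
case=> m [m' [z [mm' z3 lE]]]; have derv := vfield_der alpha.
have z3P : (z%:MP : {mpoly k[2]}) ^+ 3 = 1 by rewrite -rmorphXn /= z3 mpolyC1.
case: lE => ->.
  rewrite (derB derv) vfieldC subr0.
  have [[-> _]|[-> _]] := ord2_neq mm'; rewrite ?vfieldX ?vfieldY /vx /vy -z3P.
    by rewrite cube_sub; do 2!apply: mdivides_mulr; apply: mdivides_refl.
  by rewrite cube_sub; do 2!apply: mdivides_mulr; apply: mdivides_refl.
apply/dvd_subst; first by rewrite substM substC substX eq_sym (negbTE mm').
have [[-> ->]|[-> ->]] := ord2_neq mm'.
  rewrite (derB derv) (derM derv) vfieldC mul0r add0r vfieldX vfieldY /vx /vy.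
  rewrite !(substM, substB, substXn, subst1, substC, substX) /=.
  move: z3P; set u := z%:MP => u3.
  set t := (X in X = 0); have -> : t = (u ^+ 3 - 1) * ('X_1 ^+ 3 * (u * 'X_1 -
    alpha%:MP * 'X_1 ^+ 2) + ('X_1 ^+ 3 - 1) * (alpha%:MP * 'X_1 ^+ 2)).
    by rewrite /t; ring.
  by rewrite u3 subrr mul0r.
rewrite (derB derv) (derM derv) vfieldC mul0r add0r vfieldX vfieldY /vx /vy.
rewrite !(substM, substB, substXn, subst1, substC, substX) /=.
move: z3P; set u := z%:MP => u3.
set t := (X in X = 0); have -> : t = (u ^+ 3 - 1) * ('X_0 ^+ 3 * (u * 'X_0 -
  alpha%:MP * 'X_0 ^+ 2) + ('X_0 ^+ 3 - 1) * (alpha%:MP * 'X_0 ^+ 2)).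
  by rewrite /t; ring.
by rewrite u3 subrr mul0r.
Qed.

(** The cofactor is evaluated at a point of [l] on no other of the nine lines. The values are 3 z^2
    up to sign and 12 z^2, whence the conditions on 2 and 3. *)
Lemma affine_line_simple l : 2%:R != 0 :> k -> 3%:R != 0 :> k -> affine_line l ->
  exists2 q, nine_affine k = q * l & ~ mdivides l q.
Proof.
move=> two0 three0 [m [m' [z [mm' z3 lE]]]]; have z0 := cube_neq0 z3.
have z3P : (z%:MP : {mpoly k[2]}) ^+ 3 = 1 by rewrite -rmorphXn /= z3 mpolyC1.
have ev (v : 'I_2 -> k) i : ('X_i : {mpoly k[2]}).@[v] = v i by exact: mevalXU.
have ndvd (f q : {mpoly k[2]}) v : f.@[v] = 0 -> q.@[v] != 0 -> ~ mdivides f q.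
  by move=> fv /eqP qv [h hE]; apply: qv; rewrite hE mevalM fv mulr0.
pose q (u v : {mpoly k[2]}) := u ^+ 2 + u * v + v ^+ 2.
pose pt (a b : k) (i : 'I_2) := if i == 0 then a else b.
have tz : 3%:R * z ^+ 2 != 0 by rewrite mulf_neq0 ?expf_neq0.
have z3' : z * (z * z) = 1 by [].
have z3n : - z * (- z * - z) = - 1 by rewrite mulrNN mulNr z3'.
have tz4 : 3%:R * z ^+ 2 * (2%:R * 2%:R) != 0 by rewrite !mulf_neq0.
case: lE => ->; have [[-> m'E]|[-> m'E]] := ord2_neq mm'; rewrite ?m'E {m'E}.
- exists (q 'X_0 z%:MP * ('X_1 ^+ 3 - 1) * ('X_0 ^+ 3 - 'X_1 ^+ 3)).
    by rewrite /nine_affine -{1}z3P cube_sub /q; ring.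
  apply: (ndvd _ _ (pt z 0)).
    by rewrite mevalB mevalC ev subrr.
  rewrite /q !(mevalM, mevalB, mevalD, rmorphXn, mevalC, meval1) /= !ev /pt /=.
  rewrite z3' (_ : _ * _ = - (3%:R * z ^+ 2)) ?oppr_eq0 //; ring.
- exists (q 'X_1 z%:MP * ('X_0 ^+ 3 - 1) * ('X_0 ^+ 3 - 'X_1 ^+ 3)).
    by rewrite /nine_affine -{2}z3P cube_sub /q; ring.
  apply: (ndvd _ _ (pt 0 z)).
    by rewrite mevalB mevalC ev subrr.
  rewrite /q !(mevalM, mevalB, mevalD, rmorphXn, mevalC, meval1) /= !ev /pt /=.
  rewrite z3' (_ : _ * _ = 3%:R * z ^+ 2) //; ring.
- exists (q 'X_0 (z%:MP * 'X_1) * ('X_0 ^+ 3 - 1) * ('X_1 ^+ 3 - 1)).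
    rewrite /nine_affine.
    rewrite (_ : 'X_0 ^+ 3 - 'X_1 ^+ 3 = 'X_0 ^+ 3 - (z%:MP * 'X_1) ^+ 3).
      by rewrite [in LHS]cube_sub /q; ring.
    by rewrite exprMn z3P mul1r.
  apply: (ndvd _ _ (pt (- z) (- 1))).
    by rewrite mevalB mevalM mevalC !ev /pt /= mulrN1 subrr.
  rewrite /q !(mevalM, mevalB, mevalD, rmorphXn, mevalC, meval1) /= !ev /pt /=.
  rewrite z3n (_ : _ * _ = 3%:R * z ^+ 2 * (2%:R * 2%:R)) //; ring.
- exists (- (q 'X_1 (z%:MP * 'X_0) * ('X_0 ^+ 3 - 1) * ('X_1 ^+ 3 - 1))).
    rewrite /nine_affine.
    rewrite (_ : 'X_0 ^+ 3 - 'X_1 ^+ 3 = - ('X_1 ^+ 3 - (z%:MP * 'X_0) ^+ 3)).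
      by rewrite [in LHS]cube_sub /q; ring.
    by rewrite exprMn z3P mul1r opprB.
  apply: (ndvd _ _ (pt (- 1) (- z))).
    by rewrite mevalB mevalM mevalC !ev /pt /= mulrN1 subrr.
  rewrite /q mevalN !(mevalM, mevalB, mevalD, rmorphXn, mevalC, meval1) /= !ev /pt /=.
  rewrite z3n oppr_eq0.
  rewrite (_ : _ * _ = 3%:R * z ^+ 2 * (2%:R * 2%:R)) //; ring.
Qed.

Lemma dehom_nine_form i : exists2 c : k, c != 0 &
  dehom i nine_form = c%:MP * nine_affine k.
Proof.
have N1 : (- 1)%:MP = - 1 :> {mpoly k[2]} by rewrite mpolyCN mpolyC1.
have m1 : - 1 != 0 :> k by rewrite oppr_eq0 oner_eq0.
rewrite /nine_form /nine_affine !(dehomM, dehomD, dehomN, dehomXn).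
elim/ord3_ind: i.
- by exists (- 1) => //; have [-> -> ->] := dehom_chart0 k; rewrite N1; ring.
- exists 1; first exact: oner_neq0.
  by have [-> -> ->] := dehom_chart1 k; rewrite mpolyC1; ring.
- by exists (- 1) => //; have [-> -> ->] := dehom_chart2 k; rewrite N1; ring.
Qed.

End Lines.

(** * Curves *)

Section PthPowers.

Variables (k : closedFieldType) (n p : nat).
Hypothesis charp : p \in [pchar k].

Lemma mderiv_eq0_dvd (f : {mpoly k[n]}) j m :
  f^`M(j) = 0 -> m \in msupp f -> (p %| m j)%N.
Proof.
move=> f0 mf; have [->|mj] := posnP (m j); first exact: dvdn0.
have mE : (m = (m - U_(j)) + U_(j))%MM.
  rewrite submK //; apply/mnm_lepP => l; rewrite mnm1E.
  by case: eqP => [<-|_].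
have := congr1 (mcoeff (m - U_(j))) f0; rewrite mcoeff_mderiv -mE mcoeff0.
rewrite mnmBE mnm1E eqxx subn1 prednK // -mulr_natr => /eqP.
by rewrite mulf_eq0 mcoeff_eq0 mf /= (dvdn_pcharf charp).
Qed.

Lemma mpoly_exp (f : {mpoly k[n]}) :
  (forall m j, m \in msupp f -> (p %| m j)%N) -> exists g, f = g ^+ p.
Proof.
have p_gt0 := prime_gt0 (pcharf_prime charp) => pf.
have charP : p \in [pchar {mpoly k[n]}].
  by rewrite (rmorph_pchar (@mpolyC n k)).
pose r m := sval (cid (closed_root (f@_m) p_gt0)).
have rE m : r m ^+ p = f@_m by rewrite /r; case: cid.
exists (\sum_(m <- msupp f) (r m)%:MP * 'X_[[multinom (m j %/ p)%N | j < n]]).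
rewrite {1}[f]mpolyE -(pFrobenius_autE charP) rmorph_sum /=.
apply: eq_big_seq => m mf; rewrite pFrobenius_autE exprMn -rmorphXn /= rE.
rewrite mul_mpolyC mpolyXn; congr (_ *: 'X_[_]).
by apply/mnmP => j; rewrite mulmnE mnmE divnK ?pf.
Qed.

End PthPowers.

Lemma msize_mderiv_lt (k : fieldType) n (f : {mpoly k[n]}) i :
  f^`M(i) != 0 -> (msize f^`M(i) < msize f)%N.
Proof.
move=> f0; rewrite -mlead_deg //.
have := mlead_supp f0; rewrite mcoeff_msupp mcoeff_mderiv => mf.
have : (mlead f^`M(i) + U_(i))%MM \in msupp f.
  by rewrite mcoeff_msupp; apply: contraNneq mf => ->; rewrite mul0rn.
by move/msize_mdeg_lt; rewrite mdegD mdeg1 addn1.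
Qed.

(** A nonzero multiple of [f] has at least the degree of [f], but differentiation lowers the
    degree. *)
Lemma dvd_mderiv_eq0 (k : fieldType) n (f : {mpoly k[n]}) i :
  mdivides f f^`M(i) -> f^`M(i) = 0.
Proof.
move=> [h hE]; apply/eqP; case: eqP => // /eqP f0.
have := msize_mderiv_lt f0; rewrite hE; move: f0; rewrite hE mulf_eq0 negb_or.
case/andP=> h0 fn0; rewrite msizeM // -subn1 ltnNge leq_subRL ?leq_add2r ?addn_gt0;
  by rewrite lt0n msize_poly_eq0 h0.
Qed.

Lemma homog_mderiv (k : fieldType) n d (f : {mpoly k[n]}) i :
  f \is d.+1.-homog -> f^`M(i) \is d.-homog.
Proof.
move/dhomogP => fh; apply/dhomogP => m; rewrite mcoeff_msupp mcoeff_mderiv => mf.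
have : (m + U_(i))%MM \in msupp f.
  by rewrite mcoeff_msupp; apply: contraNneq mf => ->; rewrite mul0rn.
by move/fh; rewrite /= mdegD mdeg1 addn1 => -[].
Qed.

Lemma var_nonunit (k : fieldType) n (i : 'I_n) :
  ('X_i : {mpoly k[n]}) \isn't a GRing.unit.
Proof.
have s0 : subst i (0 : {mpoly k[n]}) 0 = 0 by exact: rmorph0.
by have [] := mprime_subst s0; rewrite subr0.
Qed.

Lemma curve_assoc (k : closedFieldType) (C : curve k) l :
  l \isn't a GRing.unit -> mdivides l C ->
  exists2 c, c != 0 & (C : {mpoly k[3]}) = c%:MP * l.
Proof.
move=> lnu [h hE]; have [_ Cirr] := curve_irreducible C.
have [/mpoly_unitP[c c0 hc]|lu] := Cirr _ _ hE; first by exists c; rewrite ?hE ?hc.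
by rewrite lu in lnu.
Qed.

(** * Generators of the tangent and conormal sheaves *)

Section Derivations2.

Variable k : closedFieldType.
Implicit Types (D : {mpoly k[2]} -> {mpoly k[2]}) (eta : 'rV[{mpoly k[2]}]_2).

Lemma derivation_is_der D : derivation D -> is_der D.
Proof.
by case=> linD derD; split=> // a b; have := linD 1 a b; rewrite !scale1r.
Qed.

Lemma derivationC D c : derivation D -> D c%:MP = 0.
Proof.
move=> dD; have derD := derivation_is_der dD; case: dD => linD _.
have := linD c 1 0; rewrite addr0 (der0 derD) addr0 (der1 derD) scaler0.
by rewrite -mul_mpolyC mulr1.
Qed.

Lemma is_der_derivation D : is_der D -> (forall c, D c%:MP = 0) -> derivation D.
Proof.
move=> derD DC; split=> [c f g|f g]; last exact: derD.2.
by rewrite (derA derD) -!mul_mpolyC (derM derD) DC mul0r add0r.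
Qed.

Lemma der_mpoly2 D f : is_der D -> (forall c, D c%:MP = 0) ->
  D f = D 'X_0 * f^`M(0) + D 'X_1 * f^`M(1).
Proof.
move=> derD DC; elim/mpoly_ring_ind: f => [c|i|f g Df Dg|f g Df Dg].
- by rewrite DC !mderivC !mulr0 addr0.
- rewrite !mderiv_var; case: (eqVneq i 0) => [->|i0].
    by rewrite mulr1 mulr0 addr0.
  have -> : i = 1 by case: i i0 => [[|[|//]] i2] // _; apply/val_inj.
  by rewrite mulr1 mulr0 add0r.
- by rewrite (derA derD) Df Dg !mderivD; ring.
- by rewrite (derM derD) Df Dg !mderivM; ring.
Qed.

Lemma contractE eta D : contract eta D = eta 0 0 * D 'X_0 + eta 0 1 * D 'X_1.
Proof.
rewrite /contract !big_ord_recl big_ord0 addr0.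
rewrite (_ : lift ord0 ord0 = 1); last exact/val_inj.
by rewrite (_ : ord0 = 0) //; apply/val_inj.
Qed.

End Derivations2.

Section Generators.

Variables (k : closedFieldType) (alpha : k).

Lemma chart_formE i : exists e : k, [/\ e != 0,
  chart_form (F4 alpha) i 0 0 = e%:MP * vy alpha &
  chart_form (F4 alpha) i 0 1 = - (e%:MP * vx alpha)].
Proof.
have N1 : (- 1)%:MP = - 1 :> {mpoly k[2]} by rewrite mpolyCN mpolyC1.
have m1 : - 1 != 0 :> k by rewrite oppr_eq0 oner_eq0.
have p1 : 1 != 0 :> k by exact: oner_neq0.
elim/ord3_ind: i; [exists 1|exists (- 1)|exists 1]; split=> //;
  rewrite /chart_form !mxE /= -!mul_mpolyC !(dehomM, dehomD, dehomN, dehomXn, dehomC).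
- by have [-> -> ->] := dehom_chart0 k; rewrite mpolyC1 /vy; ring.
- by have [-> -> ->] := dehom_chart0 k; rewrite mpolyC1 /vx; ring.
- by have [-> -> ->] := dehom_chart1 k; rewrite N1 /vy; ring.
- by have [-> -> ->] := dehom_chart1 k; rewrite N1 /vx; ring.
- by have [-> -> ->] := dehom_chart2 k; rewrite mpolyC1 /vy; ring.
- by have [-> -> ->] := dehom_chart2 k; rewrite mpolyC1 /vx; ring.
Qed.

(** The prime factors of [vx] are the lines X = z with z^3 = 1 and the parabola X = alpha Y^2;
    substituting any of them into [vy] leaves a nonzero polynomial in Y. This coprimality yields
    both generator statements. *)
Lemma vx_vy_coprime f g : vx alpha * f = vy alpha * g ->
  exists h, f = h * vy alpha /\ g = h * vx alpha.
Proof.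
move=> E; have [w w_root] := primitive_cube_root k.
pose s := [seq ('X_0 - z%:MP : {mpoly k[2]}) | z <- cube_roots w] ++
          [:: 'X_0 - alpha%:MP * 'X_1 ^+ 2].
have sE : \prod_(l <- s) l = vx alpha.
  rewrite /s big_cat big_seq1 big_map /vx -[in RHS](expr1n _ 3).
  rewrite (subr3_factor w_root); congr (_ * _).
  by apply: eq_bigr => z _; rewrite mulr1.
have ev (v : 'I_2 -> k) i : ('X_i : {mpoly k[2]}).@[v] = v i by exact: mevalXU.
have evE := (mevalM, mevalB, mevalD, mevalC, meval1, rmorphXn, ev).
have cube0 i : ('X_i : {mpoly k[2]}) ^+ 3 - 1 != 0.
  apply: (@meval_neq0 _ _ _ (fun=> 0)).
  by rewrite !evE /= ?ev ?expr0n ?mul0r sub0r oppr_eq0 oner_neq0.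
have X0 i : ('X_i : {mpoly k[2]}) != 0.
  by apply: (@meval_neq0 _ _ _ (fun=> 1)); rewrite ev oner_neq0.
have vx0 : vx alpha != 0.
  rewrite mulf_neq0 //; apply: (@meval_neq0 _ _ _ (fun j => (j == 0)%:R)).
  by rewrite !evE /= ?ev ?expr0n ?mul0r mulr0 subr0 oner_neq0.
have [||h hE] := @prod_mprime_coprime _ _ s (vy alpha) g.
- move=> l; rewrite mem_cat mem_seq1 => /orP[/mapP[z _ ->]|/eqP->].
    have sz : subst 0 z%:MP z%:MP = z%:MP :> {mpoly k[2]} by rewrite substC.
    split; [|exact: mprime_subst|].
      apply: (@meval_neq0 _ _ _ (fun=> z + 1)).
      by rewrite !evE addrC addKr oner_neq0.
    move/(dvd_subst sz)/eqP.
    rewrite /vy !(substM, substB, substXn, subst1, substC, substX) /=.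
    rewrite mulf_eq0 (negbTE (cube0 1)) /=; apply/negP.
    apply: (@meval_neq0 _ _ _ (fun=> alpha * z ^+ 2 + 1)).
    by rewrite !evE expr2 addrC addKr oner_neq0.
  have sz : subst 0 (alpha%:MP * 'X_1 ^+ 2) (alpha%:MP * 'X_1 ^+ 2) =
            alpha%:MP * 'X_1 ^+ 2 :> {mpoly k[2]}.
    by rewrite substM substXn substC substX.
  split; [|exact: mprime_subst|].
    apply: (@meval_neq0 _ _ _ (fun j => (j == 0)%:R)).
    by rewrite !evE /= ?ev ?expr0n ?mul0r mulr0 subr0 oner_neq0.
  move/(dvd_subst sz)/eqP.
  rewrite /vy !(substM, substB, substXn, subst1, substC, substX) /=.
  rewrite mulf_eq0 (negbTE (cube0 1)) /=; apply/negP.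
  rewrite (_ : _ - _ = 'X_1 * (1 - alpha%:MP ^+ 3 * 'X_1 ^+ 3)); last by ring.
  rewrite mulf_neq0 //; apply: (@meval_neq0 _ _ _ (fun=> 0)).
  by rewrite !evE /= ?ev ?expr0n ?mul0r mulr0 subr0 oner_neq0.
- by exists f; rewrite -E sE mulrC.
exists h; split; last by rewrite hE sE.
by apply: (mulfI vx0); rewrite E hE sE; ring.
Qed.

Lemma vfield_tangent i : tangent (F4 alpha) i (vfield alpha).
Proof.
split.
  by apply: is_der_derivation; [exact: vfield_der|exact: vfieldC].
have [e [_ e0 e1]] := chart_formE i.
by rewrite contractE e0 e1 vfieldX vfieldY; ring.
Qed.

(** Tangency of [D] means vx * D Y = vy * D X up to a nonzero constant, so coprimality makes [D] a
    multiple of the field. *)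
Lemma vfield_generator i : tangent_generator (F4 alpha) i (vfield alpha).
Proof.
split=> [|D [dD]]; first exact: vfield_tangent.
have [e [en0 e0 e1]] := chart_formE i.
rewrite contractE e0 e1 => E.
have [h [h1 h0]] : exists h, D 'X_1 = h * vy alpha /\ D 'X_0 = h * vx alpha.
  apply: vx_vy_coprime; apply: (mulfI (_ : e%:MP != 0)); first by rewrite mpolyC_eq0.
  by apply/eqP; rewrite eq_sym -subr_eq0 -E; apply/eqP; ring.
exists h => f; have derD := derivation_is_der dD.
rewrite (der_mpoly2 f derD) ?h0 ?h1 => [|c]; last exact: derivationC.
by rewrite /vfield; ring.
Qed.

Lemma chart_form_generator i :
  conormal_generator (F4 alpha) i (chart_form (F4 alpha) i).
Proof.
split=> [D [_ //]|theta /(_ _ (vfield_tangent i))].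
rewrite contractE vfieldX vfieldY => E.
have [e [en0 e0 e1]] := chart_formE i.
have [h [h0 h1]] : exists h, theta 0 0 = h * vy alpha /\ - theta 0 1 = h * vx alpha.
  apply: vx_vy_coprime; rewrite mulrN; apply/eqP; rewrite -subr_eq0 opprK -E.
  by apply/eqP; ring.
exists (h * e^-1%:MP); apply/rowP => j.
have eeV : e^-1%:MP * e%:MP = 1 :> {mpoly k[2]} by rewrite -mpolyCM mulVf.
rewrite mxE; case: (eqVneq j 0) => [->|j0].
  by rewrite e0 h0 mulrA -[h * _ * _]mulrA eeV mulr1.
have -> : j = 1 by case: j j0 => [[|[|//]] i2] // _; apply/val_inj.
by rewrite e1 mulrN mulrA -[h * _ * _]mulrA eeV mulr1 -h1 opprK.
Qed.

End Generators.

(** * Invariant curves *)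

Lemma mdivides_prod n (R : idomainType) (s : seq {mpoly R[n]}) l :
  l \in s -> mdivides l (\prod_(f <- s) f).
Proof.
by move=> ls; rewrite (big_rem l ls); apply: mdivides_mulr; apply: mdivides_refl.
Qed.

Lemma mdivides1_unit n (R : idomainType) (f : {mpoly R[n]}) :
  mdivides f 1 -> f \is a GRing.unit.
Proof. by case=> h hE; apply/unitrP; exists h; rewrite [f * h]mulrC -hE. Qed.

Section NineLines.

Variables (k : closedFieldType) (w : k).
Hypothesis w_root : w ^+ 2 + w + 1 = 0.

Lemma lines_mprime l : l \in lines w -> l != 0 /\ mprime l.
Proof.
move=> /(linesP w_root)[a [b [z [ab z3 ->]]]]; split; last exact: mprime_line.
apply: (@meval_neq0 _ _ _ (fun j => (j == a)%:R)).
rewrite mevalB mevalM !mevalXU eqxx [b == a]eq_sym (negbTE ab) mulr0 subr0.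
exact: oner_neq0.
Qed.

Lemma component_line (C : curve k) : component C (nine_form k) ->
  exists a b z c, [/\ a != b, z ^+ 3 = 1, c != 0 &
    (C : {mpoly k[3]}) = c%:MP * line a b z].
Proof.
rewrite /component (nine_form_lines w_root) -[\prod_(l <- _) _]mulr1 => CG.
have [[l ls lC]|] := prod_mprime_dvd lines_mprime CG.
- have [a [b [z [ab z3 lE]]]] := linesP w_root ls.
  have [c c0 CE] : exists2 c, c != 0 & (C : {mpoly k[3]}) = c%:MP * l.
    by apply: curve_assoc => //; rewrite lE; case: (mprime_line z ab).
  by exists a, b, z, c; split; rewrite -?lE.
- by move/mdivides1_unit => Cu; have [] := curve_irreducible C; rewrite Cu.
Qed.

Lemma line_component (C : curve k) l : l \in lines w -> mdivides l C ->
  component C (nine_form k).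
Proof.
move=> ls lC; have [a [b [z [ab z3 lE]]]] := linesP w_root ls.
have [c c0 CE] : exists2 c, c != 0 & (C : {mpoly k[3]}) = c%:MP * l.
  by apply: curve_assoc => //; rewrite lE; case: (mprime_line z ab).
rewrite /component (nine_form_lines w_root).
apply: mdivides_trans (mdivides_prod ls); exists c^-1%:MP.
by rewrite CE mulrA -mpolyCM mulVf // mpolyC1 mul1r.
Qed.

(** If the trace of a line divides the trace of [C], the line divides X_i^N C; being prime and not
    dividing X_i, it divides [C]. When no line does, all factors of the nine-line product can be
    cancelled. *)
Lemma dvd_nine_affine i (C : curve k) N g :
  mdivides (dehom i C) (nine_affine k ^+ N * g) ->
  component C (nine_form k) \/ mdivides (dehom i C) g.
Proof.
elim: N => [|N IH]; first by rewrite expr0 mul1r; right.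
rewrite exprS -mulrA => CP.
have [c c0 cE] := dehom_nine_form k i.
have {}CP : mdivides (dehom i C)
    (\prod_(l <- [seq dehom i l | l <- lines w]) l * (nine_affine k ^+ N * g)).
  rewrite -dehom_prod -(nine_form_lines w_root) cE -mulrA.
  exact: mdivides_mull.
have [|[l' /mapP[l ls ->] lC]|] := prod_mprime_dvd _ CP; last exact: IH.
- move=> l' /mapP[l /(linesP w_root)[a [b [z [ab z3 ->]]]] ->].
  have [e [m [e0 /mprime_affine_line[m0 mP] ->]]] := dehom_line i ab z3.
  split; first by rewrite mulf_neq0 ?mpolyC_eq0.
  by apply: mprime_unitl => //; apply: mpolyC_unit.
have [d Ch] := curve_homog C; have [a [b [z [ab z3 lE]]]] := linesP w_root ls.
have lh : l \is 1.-homog by rewrite lE; apply: line_homog.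
have [M] := dehom_dvd lh Ch lC.
have lP : mprime l by rewrite lE; apply: mprime_line.
case/(proj2 lP) => [/(mprime_exp lP)|lC']; last by left; apply: line_component lC'.
by rewrite lE => /line_ndvd_var []//; apply: cube_neq0.
Qed.

End NineLines.

Section Invariant.

Variables (k : closedFieldType) (alpha : k).

Lemma component_invariant (C : curve k) : component C (nine_form k) ->
  invariant_curve (F4 alpha) C.
Proof.
have [w w_root] := primitive_cube_root k.
move=> /(component_line w_root)[a [b [z [c [ab z3 c0 CE]]]]] i D DT.
have [_ vgen] := vfield_generator alpha i; have [g ->] := vgen D DT.
have derv := vfield_der alpha.
have [e [m [e0 mA mE]]] := dehom_line i ab z3.
rewrite CE dehomM dehomC mE mulrA -mpolyCM (derM derv) vfieldC mul0r add0r.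
apply: mdivides_mull; have [h ->] := affine_line_invariant alpha mA.
exists h; ring.
Qed.

Lemma iter_invariant (f : {mpoly k[2]}) (D : {mpoly k[2]} -> {mpoly k[2]}) m :
  is_der D -> mdivides f (D f) -> mdivides f (iter m D f).
Proof.
move=> derD [h hE]; elim: m => [|m [g gE]]; first exact: mdivides_refl.
rewrite iterS gE (derM derD) hE; apply: mdividesD.
  exact: mdivides_mull (mdivides_refl _).
by apply: mdivides_mull; apply: mdivides_mull; apply: mdivides_refl.
Qed.

(** If the trace in chart 2 is constant, [C] is a scalar times a positive power of X_2 and so meets
    chart 0. *)
Lemma curve_chart (C : curve k) : exists i, dehom i C \isn't a GRing.unit.
Proof.
have [C2|C2] := boolP (dehom 2 C \is a GRing.unit); last by exists 2.
exists 0; have [c c0 cE] := mpoly_unitP C2.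
have [d Ch] := curve_homog C; have CE := dehom_const Ch cE.
case: d {Ch} CE => [|d] CE.
  have [/negP[]] := curve_irreducible C.
  by rewrite CE expr0 mulr1; apply: mpolyC_unit.
rewrite CE dehomM dehomXn; have [_ _ ->] := dehom_chart0 k.
by rewrite unitrM exprS unitrM (negbTE (var_nonunit _ _)) andbF.
Qed.

Variables (p : nat).
Hypothesis charp : p \in [pchar k].

(** Otherwise p divides the exponents of the variables other than X_i in every monomial of [C]. If p
    divides the degree, [C] is a p-th power, contradicting irreducibility. If not, X_i divides [C],
    which is then X_i up to a scalar and has constant trace. *)
Lemma dehom_deriv_neq0 i (C : curve k) : dehom i C \isn't a GRing.unit ->
  exists m, (dehom i C)^`M(m) != 0.
Proof.
move=> Cnu; apply/existsP; apply: contraT; rewrite negb_exists => /forallP /= C0.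
have [d Ch] := curve_homog C; have /dhomogP Cd := Ch.
have Cp m j : m \in msupp C -> j != i -> (p %| m j)%N.
  move=> mC; rewrite eq_sym => /unlift_some[m' -> _].
  have [d0|d_gt0] := posnP d.
    by move/eqP: (Cd m mC); rewrite /= d0 mdeg_eq0 => /eqP->; rewrite mnm0E dvdn0.
  apply: (mderiv_eq0_dvd charp _ mC).
  apply: (@dehom_eq0 _ i d.-1); first by apply: homog_mderiv; rewrite prednK.
  by rewrite -dehom_deriv; apply/eqP; have := C0 m'; rewrite negbK.
have mi m : m \in msupp C -> ((p %| m i) = (p %| d))%N.
  move=> mC; rewrite -(Cd m mC) /= mdegE (bigD1 i) //= dvdn_addl //.
  by apply: dvdn_sum => j ji; apply: Cp.
have [_ Cirr] := curve_irreducible C.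
have [pd|pd] := boolP (p %| d)%N.
  have [g gE] : exists g, (C : {mpoly k[3]}) = g ^+ p.
    apply: (mpoly_exp charp) => m j mC; have [->|ji] := eqVneq j i; first by rewrite mi.
    exact: Cp.
  have [/negP Cu _] := curve_irreducible C; case: Cu.
  have p_gt1 := prime_gt1 (pcharf_prime charp).
  have gE' : (C : {mpoly k[3]}) = g * g ^+ p.-1 by rewrite -exprS prednK // ltnW.
  suff gu : g \is a GRing.unit by rewrite gE unitrX.
  by case: (Cirr _ _ gE') => //; rewrite unitrX_pos // -ltnS prednK // ltnW.
have : mdivides ('X_i - 0) C.
  apply/dvd_subst; first exact: rmorph0.
  rewrite [C : {mpoly k[3]}]mpolyE.
  rewrite (big_morph _ (@substD _ _ i 0) (rmorph0 _)) big1_seq // => m /= mC.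
  rewrite -mul_mpolyC substM (mpolyXE_id _ m).
  rewrite (big_morph _ (@substM _ _ i 0) (rmorph1 _)) (bigD1 i) //=.
  rewrite substXn substX eqxx expr0n; have [m0|_] := eqVneq (m i) 0%N.
    by move: pd; rewrite -(mi m mC) m0 dvdn0.
  by rewrite mul0r mulr0.
rewrite subr0 => -[h hE]; have [hu|] := Cirr _ _ hE; last first.
  by rewrite (negbTE (var_nonunit _ _)).
case/negP: Cnu; rewrite hE dehomM dehom_var mulr1.
by have [c c0 ->] := mpoly_unitP hu; rewrite dehomC mpolyC_unit.
Qed.

Lemma invariant_component (n : nat) (a : k) (C : curve k) : a != 0 ->
  wedge (vfield alpha) (iter p (vfield alpha)) = a%:MP * nine_affine k ^+ n ->
  invariant_curve (F4 alpha) C -> component C (nine_form k).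
Proof.
move=> a0 wE Cinv; have [w w_root] := primitive_cube_root k.
have [i Ci] := curve_chart C; have [m Cm] := dehom_deriv_neq0 Ci.
have fv := Cinv i _ (vfield_tangent alpha i).
set f := dehom i C in fv Ci Cm; have derv := vfield_der alpha.
have charP : p \in [pchar {mpoly k[2]}] by rewrite (rmorph_pchar (@mpolyC 2 k)).
have fvp := iter_invariant p derv fv.
have vE g : vfield alpha g = vfield alpha 'X_0 * g^`M(0) + vfield alpha 'X_1 * g^`M(1).
  by apply: der_mpoly2 => // c; apply: vfieldC.
have vpE g : iter p (vfield alpha) g = iter p (vfield alpha) 'X_0 * g^`M(0) +
                                       iter p (vfield alpha) 'X_1 * g^`M(1).
  apply: der_mpoly2; first exact: der_iterp.
  move=> c; case: p charp => [|q] /pcharf_prime // _; rewrite iterSr vfieldC.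
  by elim: q => //= q ->; rewrite (der0 derv).
(* Modulo [f], [fv] and [fvp] are two linear equations in the partial derivatives of [f], with
   determinant the wedge; Cramer's rule isolates the one along [m]. *)
have : mdivides f (wedge (vfield alpha) (iter p (vfield alpha)) * f^`M(m)).
  rewrite vE in fv; rewrite vpE in fvp; rewrite /wedge.
  move: fv fvp; set A := vfield _ _; set B := vfield _ _.
  set A' := iter _ _ _; set B' := iter _ _ _ => fv fvp.
  have [->|m0] := eqVneq m 0.
    have -> : (A * B' - B * A') * f^`M(0) =
      B' * (A * f^`M(0) + B * f^`M(1)) - B * (A' * f^`M(0) + B' * f^`M(1)) by ring.
    by apply: mdividesB; apply: mdivides_mull.
  have -> : m = 1 by case: m m0 {Cm} => [[|[|//]] i2] // _; apply/val_inj.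
  have -> : (A * B' - B * A') * f^`M(1) =
    A * (A' * f^`M(0) + B' * f^`M(1)) - A' * (A * f^`M(0) + B * f^`M(1)) by ring.
  by apply: mdividesB; apply: mdivides_mull.
rewrite wE -mulrA => /(mdivides_mull a^-1%:MP).
rewrite (mulrA a^-1%:MP) -mpolyCM mulVf // mpolyC1 mul1r.
case/(dvd_nine_affine w_root) => //.
by move/dvd_mderiv_eq0 => C0; rewrite C0 eqxx in Cm.
Qed.

End Invariant.

(** * The p-divisor *)

(** The p elements of the prime field already exhaust the roots of X^p - X. *)
Lemma frobenius_fixed (k : fieldType) p (x : k) :
  p \in [pchar k] -> x ^+ p = x -> exists a : 'F_p, x = (a : nat)%:R.
Proof.
move=> charp xp; have p_pr := pcharf_prime charp.
have p_gt1 := prime_gt1 p_pr.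
pose s := [seq i%:R : k | i <- iota 0 p].
have s_root y : y \in s -> root ('X^p - 'X) y.
  case/mapP=> i _ ->; rewrite rootE !hornerE.
  by rewrite -(pFrobenius_autE charp) rmorph_nat subrr.
have sX : size ('X^p - 'X : {poly k}) = p.+1.
  by rewrite size_polyDl size_polyXn // size_polyN size_polyX.
have s_uniq : uniq s.
  rewrite map_inj_in_uniq ?iota_uniq // => i j; rewrite !mem_iota !add0n /=.
  wlog ij : i j / (i <= j)%N => [H ip jp E|ip jp E].
    by case: (leqP i j) => [|/ltnW] le; [|apply/esym]; apply: H.
  apply/eqP; rewrite eqn_leq ij /= -subn_eq0.
  have : (p %| j - i)%N by rewrite (dvdn_pcharf charp) natrB // E subrr.
  case: (posnP (j - i)) => [->//|ji /(dvdn_leq ji)].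
  by rewrite leqNgt (leq_ltn_trans (leq_subr _ _) jp).
have [/mapP[i]|xs] := boolP (x \in s).
  rewrite mem_iota add0n => /= ip ->; exists (i%:R).
  by rewrite val_Fp_nat // modn_small.
have : (size (x :: s) < p.+1)%N.
  rewrite -sX; apply: max_poly_roots; rewrite -?size_poly_gt0 ?sX //=.
    rewrite rootE !hornerE xp subrr eqxx /=; exact/allP.
  by rewrite xs s_uniq.
by rewrite /= size_map size_iota ltnn.
Qed.

Theorem theorem6p8 (k : closedFieldType) (p : nat) (alpha : k)
    (charp : p \in [pchar k]) (p_gt3 : (3 < p)%N) (p_mod3 : p = 1 %[mod 3])
    (alphaNFp : ~ exists a : 'F_p, alpha = (a : nat)%:R) :
  is_p_divisor (F4 alpha) p (fun C => ((p + 2) %/ 3 * nine_lines C)%N) /\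
  forall C : curve k, invariant_curve (F4 alpha) C <-> (0 < nine_lines C)%N.
Proof.
have p_pr := pcharf_prime charp.
have [n pE] : exists n, p = (3 * n).+1.
  by exists (p %/ 3)%N; rewrite {1}(divn_eq p 3) p_mod3 mulnC addn1.
have mult : ((p + 2) %/ 3 = n.+1)%N.
  by rewrite pE addSnnS -[3%N in X in (X %/ _)%N]muln1 -mulnDr mulKn // addn1.
have alpha_p : alpha - alpha ^+ p != 0.
  by rewrite subr_eq0 eq_sym; apply/eqP => /(frobenius_fixed charp).
have alpha0 : alpha != 0.
  by apply: contraNneq alpha_p => ->; rewrite expr0n eqn0Ngt prime_gt0 // subrr.
have [a' [a'0 wE]] := wedge_vfield charp pE alpha0.
set a := (alpha - alpha ^+ p) * a' in wE; have a0 : a != 0 by rewrite mulf_neq0.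
have natr0 m : (0 < m < 4)%N -> m%:R != 0 :> k.
  case/andP=> m_gt0 m4; rewrite -(dvdn_pcharf charp).
  by apply/negP => /(dvdn_leq m_gt0); rewrite leqNgt (leq_ltn_trans _ p_gt3) // -ltnS.
have nine_linesE (C : curve k) : nine_lines C = `[< component C (nine_form k) >] :> nat.
  by [].
have [w w_root] := primitive_cube_root k.
split; last first.
  move=> C; rewrite nine_linesE lt0b; split=> [/(invariant_component charp a0 wE)|].
    by move=> ?; apply/asboolP.
  by move/asboolP; apply: component_invariant.
split.
  move/(_ 0 _ (vfield_generator alpha 0)); rewrite wE => /eqP.
  rewrite mulf_eq0 mpolyC_eq0 (negbTE a0) /= expf_eq0 /=.
  by rewrite (negbTE (nine_affine_neq0 k)).
exists (fun=> vfield alpha), (chart_form (F4 alpha)); split=> [i|i C Ci].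
  by split; [exact: vfield_generator|exact: chart_form_generator].
have [e [e0 E0 E1]] := chart_formE alpha i.
(* The chart form is e (vy, - vx), so the contraction is - e times the wedge. *)
have sE : contract (chart_form (F4 alpha) i) (iter p (vfield alpha)) =
          (- (e * a))%:MP * nine_affine k ^+ n.+1.
  rewrite mpolyCN mpolyCM mulNr -mulrA -wE contractE E0 E1 /wedge vfieldX vfieldY.
  by ring.
have ea0 : - (e * a) != 0 by rewrite oppr_eq0 mulf_neq0.
rewrite sE mult nine_linesE; case: asboolP => CG /=; rewrite ?muln1 ?muln0.
  (* For a component, the trace is a unit times an affine line [m], which divides [nine_affine]
     exactly once; the power n + 1 gives the multiplicity. *)
  have [b [b' [z [c [bb' z3 c0 CE]]]]] := component_line w_root CG.
  have [e' [m [e'0 mA mE]]] := dehom_line i bb' z3.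
  have [q qE qm] := affine_line_simple (natr0 2 isT) (natr0 3 isT) mA.
  have [m0 mP] := mprime_affine_line mA.
  have fE : dehom i C = (c * e')%:MP * m by rewrite CE dehomM dehomC mE mulrA -mpolyCM.
  have ce0 : c * e' != 0 by rewrite mulf_neq0.
  split.
    exists ((- (e * a) / (c * e') ^+ n.+1)%:MP * q ^+ n.+1).
    rewrite qE fE [(q * m) ^+ _]exprMn [(_%:MP * m) ^+ _]exprMn -rmorphXn /=.
    by rewrite [RHS]mulrACA -mpolyCM divfK ?expf_neq0.
  rewrite qE fE [(q * m) ^+ _]exprMn [(_%:MP * m) ^+ _]exprMn -rmorphXn /= => -[h hE].
  (* Cancelling m^(n+1) against m^(n+2) shows that m divides q^(n+1), hence q. *)
  apply: qm; apply: (@mprime_exp _ _ _ _ n.+1 mP).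
  exists ((- (e * a))^-1%:MP * (h * ((c * e') ^+ n.+2)%:MP)).
  apply: (mulIf (expf_neq0 n.+1 m0)).
  rewrite -[LHS]mul1r -mpolyC1 -(mulVf ea0) mpolyCM -mulrA hE exprS.
  by rewrite !mulrA.
rewrite /vanishing_order expr0 expr1; split.
  by exists ((- (e * a))%:MP * nine_affine k ^+ n.+1); rewrite mulr1.
(* As [C] is not a component, its trace would divide a nonzero constant, contradicting [Ci]. *)
rewrite mulrC => /(dvd_nine_affine w_root)[//|] Cc.
case/negP: Ci; apply: mdivides1_unit; apply: mdivides_trans Cc _.
by exists (- (e * a))^-1%:MP; rewrite -mpolyCM mulVf // mpolyC1.
Qed.
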